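(* For $r>0$, let $\rho_{r,\infty}$ be the normalized area measure on the disk $\{z\in\mathbb C:|z|<r\}$, i.e. $d\rho_{r,\infty}=\frac{dA}{\pi r^2}$ restricted to that disk. Then $\rho_{r,\infty}$ is arithmetic if and only if $r\ge e^{1/2}$.
   Context: A probability measure $\mu$ supported on a compact set $E\subset\mathbb C$ that is symmetric about the real axis is called arithmetic if there exists a sequence of algebraic integers $(\alpha_n)_{n\ge1}$ with the following two properties: 1. For every open neighborhood $U\supset E$ there is $N$ such that all Galois conjugates (over $\mathbb Q$) in $\mathbb C$ of $\alpha_n$ lie in $U$ for all $n\ge N$. 2. The uniform probability measures $[\alpha_n]_\infty=\frac1{\deg\alpha_n}\sum_{\beta}\delta_\beta$, with $\beta$ ranging over the complex conjugates of $\alpha_n$, converge weak-* to $\mu$. *)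

(* Defs.v *)
From HB Require Import structures.
From mathcomp Require Import all_boot all_order all_algebra.
From mathcomp Require Import all_classical all_reals all_analysis.
From mathcomp Require Import measurable_realfun.
From mathcomp Require Import complex ring lra.

Set Implicit Arguments.
Unset Strict Implicit.
Unset Printing Implicit Defensive.

Import Order.TTheory GRing.Theory Num.Theory.
Import numFieldNormedType.Exports.

Local Open Scope classical_set_scope.
Local Open Scope ring_scope.
Local Open Scope complex_scope.

HB.instance Definition _ (R : realType) := NormedModule.copy R[i] R[i]^o.
HB.instance Definition _ (R : realType) :=
  Measurable.copy R[i] (g_sigma_algebraType (@open R[i])).

Section area.
Context {R : realType}.

Definition of_plane (p : measurableTypeR R * measurableTypeR R) : R[i] :=
  p.1 +i* p.2.

Lemma norm_of_plane_le (x y : R) : `|x +i* y| <= (`|x| + `|y|)%:C.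
Proof.
rewrite normc_def lecR.
rewrite -[leRHS]ger0_norm ?addr_ge0// -sqrtr_sqr ler_wsqrtr//.
rewrite sqrrD !real_normK ?num_real// addrAC lerDl.
by rewrite mulrn_wge0// mulr_ge0.
Qed.

Lemma measurable_of_plane : measurable_fun setT of_plane.
Proof.
apply: (@measurability _ _ _ _ _ _ (@open R[i])) => // _ [U oU <-].
rewrite setTI.
pose box (a b : rat) (n : nat) : set (measurableTypeR R * measurableTypeR R) :=
  ball (ratr a : R) n.+1%:R^-1 `*` ball (ratr b : R) n.+1%:R^-1.
have -> : of_plane @^-1` U = \bigcup_a \bigcup_b \bigcup_n
    (if `[< box a b n `<=` of_plane @^-1` U >] then box a b n else set0).
  apply/seteqP; split=> [[x y] Uxy|p [a _ [b _ [n _]]]]; last first.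
    by case: asboolP => // + pbox; exact.
  have : nbhs (x +i* y) U by rewrite nbhsE; exists U.
  rewrite -nbhs_ballE => -[e /= e0 eU].
  have eE : e = (complex.Re e)%:C by rewrite RRe_real// gtr0_real.
  rewrite eE ltcR in e0; rewrite {}eE in eU.
  move: (complex.Re e) e0 eU => {}e e0 eU.
  have [n] : exists n, 0 + n.+1%:R^-1 < e / 4.
    by apply/ltr_add_invr; rewrite divr_gt0.
  have n0 : 0 < n.+1%:R^-1 :> R by rewrite invr_gt0.
  have [a] := @rat_in_itvoo R (x - n.+1%:R^-1) (x + n.+1%:R^-1)
    ltac:(by rewrite ltrD2l gtrN).
  have [b] := @rat_in_itvoo R (y - n.+1%:R^-1) (y + n.+1%:R^-1)
    ltac:(by rewrite ltrD2l gtrN).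
  rewrite !in_itv/= -!ltr_distlC add0r => yb xa ne.
  exists a => //; exists b => //; exists n => //.
  case: asboolP => [_|[]].
    by split; rewrite /ball/= distrC.
  move=> [x' y'] [/= ax' by']; apply: eU.
  rewrite /ball/= /of_plane/=.
  rewrite (_ : _ - _ = (x - x') +i* (y - y'))//.
  apply: le_lt_trans (norm_of_plane_le _ _) _; rewrite ltcR.
  have aux (p q p1 p2 q1 q2 k : R) : k < e / 4 -> q1 < k -> p1 < k ->
    p2 < k -> q2 < k -> q <= q1 + q2 -> p <= p1 + p2 -> p + q < e by lra.
  exact: aux ne yb xa ax' by' (ler_distD _ _ _) (ler_distD _ _ _).
apply: bigcupT_measurable_rat => a; apply: bigcupT_measurable_rat => b.
apply: bigcupT_measurable => n; case: asboolP => // _.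
by apply: measurableX; exact: measurable_ball.
Qed.

Definition area : set R[i] -> \bar R :=
  pushforward (lebesgue_measure \x lebesgue_measure)%E of_plane.


#[local] Hint Resolve measurable_of_plane : core.

Let area0 : area set0 = 0%E.
Proof. exact: measure0. Qed.

Let area_ge0 A : (0 <= area A)%E.
Proof. exact: measure_ge0. Qed.

Let area_sigma_additive : semi_sigma_additive area.
Proof. exact: measure_semi_sigma_additive. Qed.

HB.instance Definition _ := isMeasure.Build _ _ _ area
  area0 area_ge0 area_sigma_additive.

Definition disk (r : R) : set R[i] := [set z | `|z| < r%:C].

Lemma measurable_disk r : measurable (disk r).
Proof.
apply: sub_sigma_algebra; rewrite /disk.
have [r0|r0] := ltP 0 r; last first.
  rewrite (_ : [set _ | _] = set0); first exact: open0.
  apply/seteqP; split=> // z /= zr; have := le_lt_trans (normr_ge0 z) zr.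
  by rewrite ltcR ltNge r0.
rewrite (_ : [set _ | _] = ball (0 : R[i]) r%:C).
  by apply: ball_open; rewrite ltcR.
by apply/seteqP; split=> z; rewrite /ball/= sub0r normrN.
Qed.

Lemma area_disk (r : R) : 0 < r -> area (disk r) = (pi * r ^+ 2)%:E.
Proof.
move=> r0; rewrite /area /pushforward /product_measure1/=.
pose h (x : R) : R := 2 * Num.sqrt (r ^+ 2 - x ^+ 2).
have hE x : lebesgue_measure (xsection (of_plane @^-1` disk r) x) = (h x)%:E.
  rewrite (_ : xsection _ _ =
      `](- Num.sqrt (r ^+ 2 - x ^+ 2)), (Num.sqrt (r ^+ 2 - x ^+ 2))[%classic).
    rewrite lebesgue_measure_itv/= lte_fin /h; case: ltP => [_|].
      by rewrite -EFinB opprK; congr EFin; lra.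
    rewrite -subr_ge0 => h0; congr EFin; apply/esym/eqP; rewrite eq_le.
    by rewrite mulr_ge0// andbT; have := sqrtr_ge0 (r ^+ 2 - x ^+ 2); lra.
  apply/seteqP; split=> y; rewrite /xsection/= inE/= /disk/= normc_def ltcR/=;
    rewrite in_itv/= -ltr_norml.
    rewrite -{1}[r]gtr0_norm// -sqrtr_sqr ltr_sqrt ?exprn_gt0// => xyr.
    by rewrite -sqrtr_sqr ltr_sqrt; nra.
  rewrite -sqrtr_sqr => yx.
  rewrite -{1}[r]gtr0_norm// -sqrtr_sqr ltr_sqrt ?exprn_gt0//.
  have [rx|rx] := ltP 0 (r ^+ 2 - x ^+ 2); first by rewrite ltr_sqrt// in yx; lra.
  by rewrite (ler0_sqrtr rx) ltNge sqrtr_ge0 in yx.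
transitivity (\int[lebesgue_measure]_(x in
    `[(r * sin (- (pi / 2)))%R, (r * sin (pi / 2))%R]) (h x)%:E)%E.
  rewrite [RHS]integral_mkcond/=; apply: eq_integral => x _.
  rewrite hE patchE sinN sin_pihalf mulrN mulr1 mem_setE in_itv/= -ler_norml.
  case: ifPn => //; rewrite -ltNge => rx; congr EFin.
  rewrite /h ler0_sqrtr ?mulr0// subr_le0 -[x ^+ 2]real_normK ?num_real//.
  by rewrite ler_sqr ?nnegrE// ltW.
have pi0 := pi_gt0 R.
have dF (x : R) : is_derive x 1 (fun t : R => r * sin t) (r * cos x).
  by apply: is_derive_eq; rewrite /GRing.scale/=; ring.
have dFE : derive1 (fun t : R => r * sin t) = (fun x : R => r * cos x).
  by apply/funext => x; rewrite derive1E; apply: derive_val.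
have cF : continuous (fun t : R => r * sin t).
  by move=> x; apply: cvgM; [exact: cvg_cst|exact: continuous_sin].
have cF' : continuous (fun t : R => r * cos t).
  by move=> x; apply: cvgM; [exact: cvg_cst|exact: continuous_cos].
have ch : continuous h.
  move=> x; apply: cvgM; first exact: cvg_cst.
  apply: continuous_comp; last exact: sqrt_continuous.
  by apply: cvgB; [exact: cvg_cst|exact: exprn_continuous].
have pi2 : - (pi / 2) < pi / 2 :> R by lra.
have DF x y : derivable_oo_LRcontinuous (fun t : R => r * sin t) x y.
  split; first by move=> z _; have [] := dF z.
  - exact/cvg_at_right_filter/cF.
  - exact/cvg_at_left_filter/cF.
rewrite (@integration_by_substitution_increasing R (fun t : R => r * sin t) h)//; first last.
- exact: continuous_subspaceT.
- by rewrite dFE; apply/cvg_ex; eexists; exact/cvg_at_left_filter/cF'.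
- by rewrite dFE; apply/cvg_ex; eexists; exact/cvg_at_right_filter/cF'.
- by rewrite dFE => x _; exact: cF'.
- by move=> x y xI yI xy; rewrite ltr_pM2l// ltr_sin.
- exact: ltW.
rewrite dFE.
pose g (x : R) := 2 * r ^+ 2 * cos x ^+ 2.
pose G (x : R) := r ^+ 2 * (x + sin x * cos x).
have dG (x : R) : is_derive x 1 G (g x).
  apply: is_derive_eq; rewrite /GRing.scale/= /g.
  have := cos2Dsin2 x; nra.
have cG : continuous G by move=> x; apply/differentiable_continuous/derivable1_diffP;
  have [] := dG x.
transitivity (\int[lebesgue_measure]_(x in
    `[(- (pi / 2))%R, (pi / 2)%R]) (g x)%:E)%E.
  apply: eq_integral.
  move=> x; rewrite inE/= in_itv/= => xI; congr EFin.
  have cx : 0 <= cos x by apply: cos_ge0_pihalf.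
  change (h (r * sin x) * (r * cos x) = g x); rewrite /h /g.
  rewrite (_ : r ^+ 2 - _ = (r * cos x) ^+ 2).
    by rewrite sqrtr_sqr ger0_norm ?mulr_ge0 ?(ltW r0)//; ring.
  have := cos2Dsin2 x; nra.
rewrite (@continuous_FTC2 _ g G)//.
- rewrite -EFinB /G sinN cosN cos_pihalf !mulr0 !addr0 ; congr EFin; lra.
- apply: continuous_subspaceT => x; apply: cvgM; first exact: cvg_cst.
  by apply: (@cvgM _ _ _ _ cos cos); exact: continuous_cos.
- split; first by move=> z _; have [] := dG z.
  - exact/cvg_at_right_filter/cG.
  - exact/cvg_at_left_filter/cG.
- by move=> x _; rewrite derive1E; apply: derive_val.
Qed.

End area.

Section disk_uniform.
Context {R : realType}.

Let norm_ge0 (r : R) : 0 <= (pi * r ^+ 2)^-1.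
Proof. by rewrite invr_ge0 mulr_ge0 ?pi_ge0 ?sqr_ge0. Qed.

(* The proof r0 occurs in the definition only to carry the probability
   structure below. *)
Definition disk_uniform (r : R) (r0 : 0 < r) : set R[i] -> \bar R :=
  mscale (NngNum (norm_ge0 r)) (mrestr area (measurable_disk r)).

Variables (r : R) (r0 : 0 < r).

HB.instance Definition _ := Measure.on (disk_uniform r0).

Let disk_uniform_setT : disk_uniform r0 setT = 1%E.
Proof.
rewrite /disk_uniform /mscale/= /mrestr setTI area_disk// -EFinM mulVf//.
by rewrite mulf_neq0 ?expf_neq0 ?gt_eqF ?pi_gt0.
Qed.

HB.instance Definition _ :=
  Measure_isProbability.Build _ _ _ (disk_uniform r0) disk_uniform_setT.

End disk_uniform.

Section conjugates.
Context {R : realType}.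
Implicit Types z : R[i].

Definition algebraic_integer z := integralOver (intr : int -> R[i]) z.

(* The minimal polynomial over the rationals; 0 if z is transcendental. *)
Definition minpolyQ z : {poly rat} :=
  xget 0 [set p : {poly rat} | [/\ p \is monic, irreducible_poly p
    & root (map_poly (ratr : rat -> R[i]) p) z]].

(* All complex roots of the minimal polynomial; they are simple. *)
Definition galois_conjugates z : seq R[i] :=
  sval (closed_field_poly_normal (map_poly (ratr : rat -> R[i]) (minpolyQ z))).

Definition algdegree z : nat := (size (minpolyQ z)).-1.

Definition conjugate_measure z : set R[i] -> \bar R :=
  mscale ((algdegree z)%:R^-1)%:nng
    (msum (fun k => dirac (nth 0 (galois_conjugates z) k))
       (size (galois_conjugates z))).

HB.instance Definition _ z := Measure.on (conjugate_measure z).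

End conjugates.

Section arithmetic.
Context {R : realType}.

(* Convergence in the weak-* topology of the dual of the space of compactly
   supported continuous functions. *)
Definition weak_star_cvg (mu_ : nat -> {measure set R[i] -> \bar R})
    (mu : {measure set R[i] -> \bar R}) :=
  forall f : R[i] -> R, continuous f ->
    compact (closure [set z | f z != 0]) ->
    (\int[mu_ n]_z (f z)%:E)%E @[n --> \oo] --> (\int[mu]_z (f z)%:E)%E.

Definition conj_symmetric (E : set R[i]) := forall z, E z -> E z^*.

Definition arithmetic_measure (E : set R[i]) (mu : probability R[i] R) :=
  exists alpha : nat -> R[i],
  [/\ forall n, algebraic_integer (alpha n),
      forall U : set R[i], open U -> E `<=` U ->
        exists N : nat, forall n, (N <= n)%N ->
          forall b, b \in galois_conjugates (alpha n) -> U b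
    & weak_star_cvg (fun n => conjugate_measure (alpha n)) mu].

End arithmetic.

(* Main.v *)
Require Import Defs.
From mathcomp Require Import all_boot all_order all_algebra.
From mathcomp Require Import all_classical all_reals all_analysis.
From mathcomp Require Import complex.
From mathcomp Require Import measurable_realfun ring lra zify polyrcf.
Import Order.TTheory GRing.Theory Num.Theory.
Import numFieldNormedType.Exports.
Import ComplexField.
Local Open Scope classical_set_scope.
Local Open Scope ring_scope.
Local Open Scope complex_scope.

Set Implicit Arguments.
Unset Strict Implicit.
Unset Printing Implicit Defensive.

(** Cut the disk into [m] annuli of equal mass, with radii
    [tau_j = r * sqrt (j / m)].  Both directions reduce to the size of
    [prod_j tau_j], whose square is [r^(2m) m! / m^m].

    If [r < e^(1/2)], this product is less than 1 for some [m], so that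
    [ln |z|], truncated near 0, has negative integral; but its average over
    the conjugates of a nonzero algebraic integer is nonnegative, because their
    product is a nonzero integer up to sign.

    If [r >= e^(1/2)], the product exceeds 1, and one can choose [sigma_j]
    between consecutive [tau_j] with product at least 1.  Consider the monic
    integer polynomial [P] of degree [m] with alternating signs whose coefficient
    of [w^j] is of the order of [(sigma_j * ... * sigma_(m-1))^N], rounded so that
    Eisenstein's criterion holds at 2.  For large [N], at [w = tau_j^N] the [j]-th
    term dominates, which forces [m] sign changes, hence one real root in
    each [(tau_j^N, tau_(j+1)^N)].  The roots of the irreducible polynomial [P(z^N)]
    are thus spread evenly on [m] circles, one in each annulus. *)

(** * Minimal polynomials of algebraic integers *)

Section minpolyQ_theory.
Context {R : realType}.
Implicit Types z : R[i].

Local Notation QtoC := (map_poly (ratr : rat -> R[i])).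

(** The rational gcd is not constant, since [z] is still a common root after extending scalars.
    Irreducibility makes both polynomials associate to it. *)
Lemma irreducible_root_uniq z (p q : {poly rat}) :
  p \is monic -> irreducible_poly p -> root (QtoC p) z ->
  q \is monic -> irreducible_poly q -> root (QtoC q) z -> p = q.
Proof.
move=> mp [_ ip] pz mq [_ iq] qz.
have g1 : size (gcdp p q) != 1.
  apply/negP => /size_poly1P[c c0 gE].
  have : root (QtoC (gcdp p q)) z by rewrite gcdp_map root_gcd pz qz.
  by rewrite gE map_polyC rootC fmorph_eq0 (negbTE c0).
have e1 := ip _ g1 (dvdp_gcdl p q); have e2 := iq _ g1 (dvdp_gcdr p q).
by apply/eqP; rewrite -eqp_monic//; apply: eqp_trans e2; rewrite eqp_sym.
Qed.

Lemma minpolyQ_unique z (p : {poly rat}) :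
  p \is monic -> irreducible_poly p -> root (QtoC p) z -> minpolyQ z = p.
Proof.
move=> mp ip pz; rewrite /minpolyQ; case: xgetP => [q _ [mq iq qz]|/(_ p)[]//].
exact: (@irreducible_root_uniq z).
Qed.

(** A monic rational polynomial of least size vanishing at [z] is irreducible: in a factorization
    [e * d] one factor vanishes at [z], hence already has full size. *)
Lemma minpolyQP z : algebraic_integer z ->
  [/\ minpolyQ z \is monic, irreducible_poly (minpolyQ z)
    & root (QtoC (minpolyQ z)) z].
Proof.
move=> [q mq qz].
pose P n := `[< exists p : {poly rat}, [/\ p \is monic, size p = n & root (QtoC p) z] >].
have Pq : exists n, P n.
  exists (size (map_poly (intr : int -> rat) q)); apply/asboolP.
  exists (map_poly intr q); split=> //.
    by rewrite monic_map.
  by rewrite -map_poly_comp (eq_map_poly (fun n => rmorph_int _ n)).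
case: (ex_minnP Pq) => n /asboolP[p [mp sp pz]] nmin.
suff ip : irreducible_poly p by rewrite (minpolyQ_unique mp ip pz).
have p0 := monic_neq0 mp.
split.
  rewrite ltnNge; apply/negP => /size1_polyC pE.
  by move: pz p0; rewrite pE map_polyC rootC fmorph_eq0 polyC_eq0 => ->.
move=> d d1 dp; have d0 : d != 0 by apply: contraNneq p0 => d0; rewrite -dvd0p -d0.
have [e pe] := dvdpP _ _ dp.
have e0 : e != 0 by apply: contraNneq p0 => e0; rewrite pe e0 mul0r.
have key (u : {poly rat}) : u != 0 -> root (QtoC u) z -> (size p <= size u)%N.
  move=> u0 uz; rewrite sp; apply: (leq_trans (nmin (size u) _)) => //.
  apply/asboolP; exists ((lead_coef u)^-1 *: u); split.
  - by rewrite monicE lead_coefZ mulVf// lead_coef_eq0.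
  - by rewrite size_scale// invr_eq0 lead_coef_eq0.
  - by rewrite map_polyZ/= rootZ// fmorph_eq0 invr_eq0 lead_coef_eq0.
move: pz; rewrite pe rmorphM/= rootM => /orP[/(key _ e0)|/(key _ d0)].
  rewrite pe size_mul// (polySpred e0) addSn/= -{2}[(size e).-1]addn0 -addnS.
  rewrite leq_add2l => sd; case/negP: d1.
  by rewrite eqn_leq sd size_poly_gt0.
by move=> sd; rewrite -pe -dvdp_size_eqp// eqn_leq sd dvdp_leq.
Qed.

(** Gauss's lemma: the minimal polynomial divides the monic integer polynomial [q] over the
    rationals, so a rational multiple [p1] of it divides [q] over the integers. The leading
    coefficient of [p1] is then a unit, and the scaling factor is 1 or -1. *)
Lemma minpolyQ_integral z : algebraic_integer z ->
  exists q : {poly int}, minpolyQ z = map_poly intr q.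
Proof.
move=> az; have [mp ip pz] := minpolyQP az; case: az => q mq qz.
set p := minpolyQ z in mp ip pz *.
have pq : p %| map_poly intr q.
  have [|cop] := boolP (coprimep p (map_poly intr q)); last first.
    case: ip => _ /(_ (gcdp p (map_poly intr q))) /(_ cop (dvdp_gcdl _ _)) e.
    by rewrite -(eqp_dvdl _ e) dvdp_gcdr.
  rewrite -(coprimep_map (ratr : {rmorphism rat -> R[i]})) => /coprimep_root/(_ pz)/negP[].
  rewrite -map_poly_comp (eq_map_poly (fun n => rmorph_int _ n)).
  exact: qz.
have [p1 [a a0 pE] [s qE]] := dvdpP_rat_int pq.

have lu : lead_coef p1 \is a GRing.unit.
  apply/unitrPr; exists (lead_coef s).
  by rewrite -lead_coefM -qE; apply/eqP.
have la : a * (lead_coef p1)%:~R = 1.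
  move/eqP: mp; rewrite pE lead_coefZ lead_coef_map_inj//; exact: intr_inj.
have aE : a = (lead_coef p1)%:~R.
  have l2 : (lead_coef p1)%:~R * (lead_coef p1)%:~R = 1 :> rat.
    by move: lu; rewrite qualifE/= => /orP[] /eqP ->.
  by have := congr1 ( *%R^~ (lead_coef p1)%:~R) la; rewrite /= -mulrA l2 mulr1 mul1r.
by exists (lead_coef p1 *: p1); rewrite pE aE map_polyZ.
Qed.

Lemma galois_conjugatesE z : algebraic_integer z ->
  QtoC (minpolyQ z) = \prod_(b <- galois_conjugates z) ('X - b%:P).
Proof.
move=> /minpolyQP[mp _ _]; rewrite /galois_conjugates.
case: closed_field_poly_normal => /= s ->.
by rewrite lead_coef_map (eqP mp) rmorph1 scale1r.
Qed.

Lemma size_galois_conjugates z : algebraic_integer z ->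
  size (galois_conjugates z) = algdegree z.
Proof.
move=> az; have /(congr1 (size : {poly _} -> nat)) := galois_conjugatesE az.
by rewrite size_map_poly size_prod_XsubC /algdegree => ->.
Qed.

(** The product is the absolute value of the constant coefficient, an integer. If it vanished, 0
    would be a root and the minimal polynomial would be ['X], forcing [z = 0]. *)
Lemma prod_conjugates_ge1 z : algebraic_integer z -> z != 0 ->
  1 <= \prod_(b <- galois_conjugates z) Normc.normc b.
Proof.
move=> az z0; have [mp ip pz] := minpolyQP az.
have [q pq] := minpolyQ_integral az.
have p0 : (minpolyQ z)`_0 != 0.
  apply: contra_neq z0 => p0.
  have mX : root (QtoC 'X) (0 : R[i]) by rewrite map_polyX rootX.
  have r0 : root (QtoC (minpolyQ z)) 0.
    by rewrite rootE horner_coef0 coef_map/= p0 fmorph_eq0.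
  have iX : irreducible_poly ('X : {poly rat}).
    by rewrite -['X]subr0; exact: irredp_XsubC.
  have pX := irreducible_root_uniq mp ip r0 (monicX _) iX mX.
  by move: pz; rewrite pX map_polyX rootX => /eqP.
have : (`|q`_0| >= 1)%R.
  by rewrite -gtz0_ge1 normr_gt0; apply: contraNneq p0; rewrite pq coef_map => ->.
have /(congr1 (fun s : {poly R[i]} => `|s.[0]|)) := galois_conjugatesE az.
rewrite horner_coef0 coef_map/= pq coef_map/= ratr_int -intr_norm.
rewrite horner_prod normr_prod.
under eq_bigr do rewrite hornerXsubC sub0r normrN.
rewrite -(ler_int R) => + q1.
rewrite -lecR rmorph_prod/= => <-.
by rewrite -(rmorph_int (real_complex R)) lecR.
Qed.

End minpolyQ_theory.

(** * Real-rooted integer polynomials with prescribed root sizes *)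

Section dominant_coefficients.
Context {R : realType}.
Variables (m : nat) (A t : nat -> R).
Hypotheses (A_ge0 : forall i, (i <= m)%N -> 0 <= A i)
  (t_ge0 : forall j, (j <= m)%N -> 0 <= t j)
  (t_incr : forall i j, (i < j <= m)%N -> t i < t j)
  (dom : forall j : 'I_m.+1,
     \sum_(i < m.+1 | i != j) A i * t j ^+ i < A j * t j ^+ j).

Let P : {poly R} := \poly_(i < m.+1) ((-1) ^+ (m - i) * A i).

(** By [dom], the [j]-th term outweighs all the others together at [t j], so it alone decides the
    sign. *)
Let sign_at (j : 'I_m.+1) : 0 < (-1) ^+ (m - j) * P.[t j].
Proof.
rewrite horner_poly mulr_sumr (bigD1 j)//= !mulrA -expr2 sqrr_sign mul1r.
apply: (@lt_le_trans _ _ (A j * t j ^+ j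
  - \sum_(i < m.+1 | i != j) A i * t j ^+ i)); first by rewrite subr_gt0.
rewrite lerD2l -sumrN ler_sum// => i _; rewrite lerNl.
apply: le_trans (ler_norm _) _; rewrite normrN !normrM !normr_sign !mul1r.
by rewrite !ger0_norm ?exprn_ge0 ?A_ge0 ?t_ge0// -ltnS.
Qed.

(** Signs at consecutive [t j] are opposite, which puts a root in each of [m] disjoint intervals.
    These are all the roots of a monic polynomial of degree [m]. *)
Lemma alternating_poly_factor : A m = 1 ->
  exists w : nat -> R, (forall j, (j < m)%N -> t j < w j < t j.+1) /\
    P = \prod_(j < m) ('X - (w j)%:P).
Proof.
move=> Am.
have /choice[w wP] : forall j, exists x, (j < m)%N -> t j < x < t j.+1 /\ root P x.
  move=> j; have [jm|] := ltnP j m; last by exists 0.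
  have jm1 : (j < m.+1)%N by rewrite ltnW.
  have tj : t j <= t j.+1 by rewrite ltW// t_incr// ltnS leqnn.
  have Pj : P.[t j] * P.[t j.+1] < 0.
    have := mulr_gt0 (sign_at (Ordinal jm1)) (sign_at (Ordinal (jm : (j.+1 < m.+1)%N))).
    rewrite /= mulrACA -exprD -(subnSK jm) addSn exprS exprD -expr2 sqrr_sign.
    by rewrite mulr1 mulN1r oppr_gt0.
  have [x] := poly_ivtoo tj Pj.
  by rewrite in_itv/= => xj rx; exists x.
exists w; split=> [j jm|]; first by have [] := wP j jm.
have lP : lead_coef P = 1 by rewrite lead_coef_poly// subnn expr0 mul1r Am ?oner_neq0.
have sP : size P = m.+1 by rewrite size_poly_eq//= subnn expr0 mul1r Am oner_neq0.
have w_incr i j : (i < j < m)%N -> w i < w j.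
  move=> /andP[ij jm].
  have [/andP[_ wi] _] := wP i (ltn_trans ij jm).
  have [/andP[wj _] _] := wP j jm.
  apply: (lt_trans wi); apply: le_lt_trans wj.
  move: ij; rewrite leq_eqVlt => /orP[/eqP->//|ij].
  by rewrite ltW// t_incr// ij ltnW.
rewrite [LHS](@all_roots_prod_XsubC _ P [seq w (val i) | i <- enum 'I_m]).
- by rewrite lP scale1r big_map big_enum.
- by rewrite sP size_map size_enum_ord.
- by apply/allP => _ /mapP[i _ ->]; have [] := wP i (ltn_ord i).
- rewrite uniq_rootsE map_inj_uniq ?enum_uniq// => i j wij; apply/val_inj => /=.
  by have [ij|ij|//] := ltngtP i j; [have := w_incr i j|have := w_incr j i];
    rewrite ij ltn_ord/= wij ltxx => /(_ isT).
Qed.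

End dominant_coefficients.

Lemma exprn_dominated {R : realType} (K a b : R) : 0 <= a < b ->
  \forall N \near \oo, K * a ^+ N < b ^+ N.
Proof.
move=> /andP[a0 ab]; have b0 := le_lt_trans a0 ab.
have [K0|K0] := ltP 0 K; last first.
  by near=> N; rewrite (@le_lt_trans _ _ 0) ?exprn_gt0// mulr_le0_ge0// exprn_ge0.
have ab1 : `|a / b| < 1 by rewrite ger0_norm ?divr_ge0 ?(ltW b0)// ltr_pdivrMr ?mul1r.
have /cvgrPdist_lt/(_ K^-1) := cvg_expr ab1.
rewrite invr_gt0 => /(_ K0); apply: filterS => N.
rewrite sub0r normrN ger0_norm ?exprn_ge0 ?divr_ge0 ?(ltW b0)//.
by rewrite expr_div_n ltr_pdivrMr ?exprn_gt0// ltr_pdivlMl.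
Unshelve. all: by end_near. Qed.

(** * Integer coefficients satisfying the dominance condition *)

Section interlacing_radii.
Context {R : realType}.
Variables (m : nat) (tau sigma : nat -> R).
Hypotheses (tau0 : tau 0%N = 0)
  (tau_sigma : forall j, (j < m)%N -> tau j < sigma j < tau j.+1)
  (prod_sigma : 1 <= \prod_(0 <= j < m) sigma j).

Let tau_le i j : (i <= j <= m)%N -> tau i <= tau j.
Proof.
move=> /andP[+ jm]; elim: j jm => [|j ih] jm; first by rewrite leqn0 => /eqP->.
rewrite leq_eqVlt => /orP[/eqP->//|]; rewrite ltnS => ij.
apply: le_trans (ih (ltnW jm) ij) _.
by have /andP[a b] := tau_sigma jm; rewrite ltW// (lt_trans a).
Qed.

Let tau_ge0 j : (j <= m)%N -> 0 <= tau j.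
Proof. by move=> jm; rewrite -tau0 tau_le. Qed.

Let sigma_gt0 j : (j < m)%N -> 0 < sigma j.
Proof.
by move=> jm; have /andP[+ _] := tau_sigma jm; apply: le_lt_trans; exact/tau_ge0/ltnW.
Qed.

Let sigma_le i j : (i <= j < m)%N -> sigma i <= sigma j.
Proof.
move=> /andP[]; rewrite leq_eqVlt => /orP[/eqP->//|ij jm].
have /andP[_ h] := tau_sigma (ltn_trans ij jm).
have /andP[h' _] := tau_sigma jm.
by rewrite ltW// (lt_le_trans h)// (le_trans _ (ltW h'))// tau_le// ij ltnW.
Qed.

(** Since [sigma] is nondecreasing, [X j] is the product of its [m - j] largest values. Its [N]-th
    power is the order of magnitude of the coefficient of degree [j] when the roots have sizes
    [sigma k ^+ N]. *)
Let X j := \prod_(j <= k < m) sigma k.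

Let XE i j : (i <= j <= m)%N -> X i = \prod_(i <= k < j) sigma k * X j.
Proof. by move=> /andP[ij jm]; rewrite /X (big_cat_nat ij jm). Qed.

Let X_gt0 j : 0 < X j.
Proof.
rewrite /X big_nat_cond; apply: prodr_gt0 => i; rewrite andbT => /andP[_ im].
exact: sigma_gt0.
Qed.

(** This keeps the effect of rounding [X j ^+ N] within a bounded factor. If [sigma j >= 1], all
    factors of [X j] are at least 1; otherwise the factors missing from [X 0] are at most 1, so that
    [X j >= X 0 >= 1]. *)
Let X_ge1 j : (j <= m)%N -> 1 <= X j.
Proof.
rewrite leq_eqVlt => /orP[/eqP->|jm]; first by rewrite /X big_geq.
have [s1|s1] := leP 1 (sigma j).
  rewrite /X big_nat_cond; apply: (big_ind (fun x => 1 <= x)) => //.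
    by move=> x y x1 y1; rewrite -[1]mulr1 ler_pM.
  by move=> i; rewrite andbT => ijm; rewrite (le_trans s1)// sigma_le.
rewrite (le_trans prod_sigma)// -/(X 0%N) (@XE 0%N j) ?(ltnW jm)//.
rewrite ler_piMl ?(ltW (X_gt0 j))// big_nat_cond.
apply: prodr_ile1 => i; rewrite andbT => /andP[_ ij].
rewrite ltW ?sigma_gt0 ?(ltn_trans ij)//=.
by rewrite (le_trans _ (ltW s1))// sigma_le// (ltnW ij).
Qed.

(** After cancellation, a power of [tau j] is compared with the product of the [sigma k] for [k]
    between [i] and [j]. These are below [tau j] when [k < j] and above it when [k >= j]. *)
Let X_dom i j : (i <= m)%N -> (j <= m)%N -> i != j ->
  X i * tau j ^+ i < X j * tau j ^+ j.
Proof.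
move=> im jm; rewrite neq_ltn => /orP[ij|ji].
- have tj : 0 < tau j.
    rewrite (lt_le_trans (sigma_gt0 (leq_trans ij jm)))//.
    have /andP[_ h] := tau_sigma (leq_trans ij jm).
    by rewrite (le_trans (ltW h))// tau_le// ij.
  have -> : tau j ^+ j = tau j ^+ (j - i) * tau j ^+ i by rewrite -exprD subnK// ltnW.
  rewrite (@XE i j) ?(ltnW ij)// mulrA ltr_pM2r ?exprn_gt0// [X in X < _]mulrC ltr_pM2l//.
  rewrite -prodr_const_nat; apply: ltr_prod_nat => // k /andP[ik kj].
  have km := leq_trans kj jm.
  have /andP[_ h] := tau_sigma km.
  by rewrite ltW ?sigma_gt0//= (lt_le_trans h)// tau_le// kj.
(* For [j = 0] the radius [tau j] is 0, but its power of exponent 0 is 1. *)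
- have tj : 0 < tau j ^+ j.
    case: (posnP j) => [->//|j0]; apply/exprn_gt0.
    have jj : (j.-1 < m)%N by case: (j) jm j0.
    rewrite (lt_trans (sigma_gt0 jj))//.
    by have /andP[_ +] := tau_sigma jj; rewrite prednK.
  have -> : tau j ^+ i = tau j ^+ (i - j) * tau j ^+ j by rewrite -exprD subnK// ltnW.
  rewrite (@XE j i) ?(ltnW ji)// mulrA ltr_pM2r// [X in _ < X]mulrC ltr_pM2l//.
  rewrite -prodr_const_nat; apply: ltr_prod_nat => // k /andP[jk ki].
  have km := leq_trans ki im.
  have /andP[h _] := tau_sigma km.
  by rewrite tau_ge0//= (le_lt_trans _ h)// tau_le// jk ltnW.
Qed.

(* Twice an odd number, for Eisenstein's criterion at 2. *)
Let a (N i : nat) : int :=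
  if (i < m)%N then 2 * (2 * Num.floor (X i ^+ N) + 1) else 1.

(** With [x = X i ^+ N >= 1], the rounded value lies between [4 * x - 2] and [4 * x + 2]. *)
Let a_bound N i : (i <= m)%N -> X i ^+ N <= (a N i)%:~R <= 6 * X i ^+ N.
Proof.
rewrite /a leq_eqVlt => /orP[/eqP->|im].
  by rewrite ltnn /X big_geq// expr1n; apply/andP; split; lra.
have x1 : 1 <= X i ^+ N by apply/exprn_ege1/X_ge1/ltnW.
rewrite im; have := floor_le (X i ^+ N); have := floorD1_gt (X i ^+ N).
by rewrite intrM !intrD intrM => h1 h2; apply/andP; split; lra.
Qed.

Lemma interlacing_int_poly : (0 < m)%N -> \forall N \near \oo,
  exists q : {poly int}, [/\ q \is monic, size q = m.+1,
    forall i, (i < m)%N -> (2 %| q`_i)%Z, ~~ (2%:Z ^+ 2 %| q`_0)%Z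
  & exists w : nat -> R, (forall j, (j < m)%N -> tau j ^+ N < w j < tau j.+1 ^+ N) /\
    map_poly intr q = \prod_(j < m) ('X - (w j)%:P)].
Proof.
move=> m0; have om (i : 'I_m.+1) : (i <= m)%N := ltn_ord i.
(* The factor 6 pays for the rounding in [a_bound], and [m.+1] for the sum over the [m] other
   indices. *)
have : \forall N \near \oo, forall ij : 'I_m.+1 * 'I_m.+1, ij.1 != ij.2 ->
    (m.+1%:R * 6) * (X ij.1 * tau ij.2 ^+ ij.1) ^+ N < (X ij.2 * tau ij.2 ^+ ij.2) ^+ N.
  apply: filter_forall => -[i j] /=; have [->|ij] := eqVneq i j.
    exact: nearW.
  apply: filterS (exprn_dominated (m.+1%:R * 6) _) => [N + _|].
    exact.
  by rewrite X_dom// andbT mulr_ge0 ?(ltW (X_gt0 _))// exprn_ge0// tau_ge0.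
move=> domN; near=> N.
have domN' : forall ij : 'I_m.+1 * 'I_m.+1, ij.1 != ij.2 ->
    (m.+1%:R * 6) * (X ij.1 * tau ij.2 ^+ ij.1) ^+ N < (X ij.2 * tau ij.2 ^+ ij.2) ^+ N.
  by near: N; exact: domN.
have N0 : (0 < N)%N by near: N; exact: nbhs_infty_gt.
pose q : {poly int} := \poly_(i < m.+1) ((-1) ^+ (m - i) * a N i).
have qm : (-1) ^+ (m - m) * a N m = 1 by rewrite subnn expr0 mul1r /a ltnn.
have sq : size q = m.+1 by rewrite size_poly_eq//= qm.
have a_ge0 i : (i <= m)%N -> 0 <= (a N i)%:~R :> R.
  move=> im; have /andP[+ _] := a_bound N im.
  by apply: le_trans; rewrite exprn_ge0// ltW.
exists q; split=> //.
- by rewrite monicE lead_coef_poly// ?qm.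
- move=> i im; rewrite coef_poly ltnS (ltnW im) /a im.
  by rewrite dvdz_mull// dvdz_mulr.
- rewrite coef_poly /= /a m0 subn0 -signr_odd.
  apply/negP => /dvdzP[k]; move: (Num.floor _) => f; rewrite expr2.
  by case: odd; rewrite ?(expr0, expr1); lia.
pose A i : R := (a N i)%:~R.
have [] := @alternating_poly_factor R m A (fun j => tau j ^+ N).
- exact: a_ge0.
- by move=> j jm; rewrite exprn_ge0// tau_ge0.
- move=> i j /andP[ij jm].
  rewrite ltrXn2r -?lt0n ?tau_ge0// ?(leq_trans (ltnW ij))//.
  have im := leq_trans ij jm.
  have /andP[h1 h2] := tau_sigma im.
  by rewrite (lt_trans h1)// (lt_le_trans h2)// tau_le// ij.
- move=> j; rewrite -(@ltr_pM2l _ m.+1%:R)// mulr_sumr.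
  (* The term strictly exceeds a nonnegative one of another index, which exists because [m > 0]. *)
  have b_gt0 : 0 < (X j * tau j ^+ j) ^+ N.
    have [i ij] : exists i : 'I_m.+1, i != j.
      exists (if j == ord0 then ord_max else ord0).
      have [->|] := eqVneq j ord0; last by rewrite eq_sym.
      by rewrite -val_eqE/= -lt0n.
    apply: le_lt_trans (domN' (i, j) ij).
    by rewrite !mulr_ge0// exprn_ge0// mulr_ge0// ?(ltW (X_gt0 _))// exprn_ge0// tau_ge0.
  apply: (@le_lt_trans _ _ (\sum_(i < m.+1 | i != j) (X j * tau j ^+ j) ^+ N)).
    apply: ler_sum => i ij; apply: le_trans (ltW (domN' (i, j) ij)); rewrite -mulrA ler_pM2l//=.
    have /andP[_ h] := a_bound N (om i).
    rewrite exprMn mulrA -exprM mulnC exprM ler_wpM2r// ?exprn_ge0// ?exprn_ge0//.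
    by rewrite tau_ge0.
  rewrite sumr_const cardC1 card_ord/= -[X in X < _]mulr_natl.
  have /andP[h _] := a_bound N (om j).
  have h' : (X j * tau j ^+ j) ^+ N <= A j * (tau j ^+ N) ^+ j.
    by rewrite exprMn -!exprM mulnC ler_wpM2r// exprn_ge0// tau_ge0.
  by rewrite (lt_le_trans _ (ler_wpM2l _ h'))// ltr_pM2r// ltr_nat.
- by rewrite /A /a ltnn.
move=> w [wP Pw]; exists w; split => //; rewrite -Pw.
apply/polyP => i; rewrite coef_map/= !coef_poly; case: ifP => // _.
by rewrite intrM; congr (_ * _); exact: rmorph_sign.
Unshelve. all: by end_near. Qed.

End interlacing_radii.

(** * Radii of annuli of equal mass *)

Section factorial_bounds.
Context {R : realType}.

(** The right side keeps the degree [m] term of the exponential series; its constant term makes the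
    inequality strict. *)
Lemma exprn_lt_expR_fact m : (0 < m)%N -> m%:R ^+ m < expR m%:R * m`!%:R :> R.
Proof.
have f0 : 0 < m`!%:R :> R by rewrite ltr0n fact_gt0.
case: m f0 => [|m] // f0 _.
rewrite -ltr_pdivrMr//; apply: lt_le_trans (expR_ge1Dxn m _) => //.
by rewrite ltrDr.
Qed.

(** Invert [1 - 1 / (m + 1) <= exp (- 1 / (m + 1))] and raise it to the power [m + 1]. *)
Lemma expR1_le_exprn m : (0 < m)%N -> expR 1 <= (m.+1%:R / m%:R) ^+ m.+1 :> R.
Proof.
move=> m0; have m1 : 0 < m%:R :> R by rewrite ltr0n.
rewrite [X in expR X](_ : 1 = m.+1%:R * m.+1%:R^-1); last by rewrite mulfV.
rewrite expRM_natl lerXn2r ?nnegrE ?expR_ge0 ?divr_ge0//.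
rewrite -[X in expR X]opprK expRN -[leRHS]invf_div lef_pV2 ?posrE ?expR_gt0 ?divr_gt0//.
apply: le_trans (expR_ge1Dx _).
have -> : m%:R / m.+1%:R = 1 - m.+1%:R^-1 :> R; last by [].
by rewrite -natr1; field; rewrite natr1.
Qed.

Lemma fact_expR_le m : (0 < m)%N ->
  m`!%:R * expR m%:R <= expR 1 * m%:R * m%:R ^+ m :> R.
Proof.
elim: m => // -[_ _|m ih _]; first by rewrite -[1`!]/1%N expr1 mul1r !mulr1.
have m1 : 0 < m.+1%:R :> R by rewrite ltr0n.
have h := ih isT; have h1 := expR1_le_exprn (isT : (0 < m.+1)%N).
have -> : m.+2`!%:R * expR m.+2%:R =
    m.+1`!%:R * expR m.+1%:R * (m.+2%:R * expR 1) :> R.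
  by rewrite factS natrM -[X in expR X]natr1 expRD [X in X * _]mulrC mulrACA.
apply: (@le_trans _ _ (expR 1 * m.+1%:R * m.+1%:R ^+ m.+1 *
    (m.+2%:R * (m.+2%:R / m.+1%:R) ^+ m.+2))).
  by rewrite ler_pM ?mulr_ge0 ?expR_ge0// ler_pM2l.
rewrite expr_div_n le_eqVlt; apply/orP; left; apply/eqP.
by rewrite !exprS; field; rewrite !expf_neq0 ?gt_eqF.
Qed.

(** Write [s = exp (1 - d)] with [d > 0]. By [fact_expR_le] it suffices that [e * m < exp (m * d)],
    and the quadratic term [(m * d) ^ 2 / 2] ensures this once [m > 2 * e / d ^ 2]. *)
Lemma exists_fact_small (s : R) : 0 < s -> s < expR 1 ->
  exists2 m, (0 < m)%N & s ^+ m * m`!%:R < m%:R ^+ m.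
Proof.
move=> s0 se; pose d : R := 1 - ln s.
have d0 : 0 < d by rewrite subr_gt0 -ltr_expR lnK.
pose m := (Num.truncn (expR 1 * 2 / d ^+ 2)).+1.
have mP : expR 1 * 2 / d ^+ 2 < m%:R by exact: truncnS_gt.
have m0 : 0 < m%:R :> R by rewrite ltr0n.
exists m => //.
have sE : s ^+ m * expR (m%:R * d) = expR m%:R.
  rewrite -[s in LHS]lnK ?posrE// -expRM_natl -expRD; congr expR.
  by rewrite /d; ring.
have ed : expR 1 * m%:R < expR (m%:R * d).
  apply: lt_le_trans (expR_ge1Dxn 1 _); last by rewrite mulr_ge0// ltW.
  rewrite -[2`!]/2%N exprMn.
  move: mP; rewrite ltr_pdivrMr ?exprn_gt0// => h.
  move: (expR 1 : R) h => x h.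
  have : x * 2 * m%:R < m%:R * d ^+ 2 * m%:R by rewrite ltr_pM2r.
  by move: (d ^+ 2) => D; rewrite expr2; move: (m%:R : R) => M; clear; lra.
rewrite -(ltr_pM2r (expR_gt0 (m%:R * d))) mulrAC sE mulrC.
apply: le_lt_trans (fact_expR_le _) _ => //.
by rewrite [ltRHS]mulrC ltr_pM2r// exprn_gt0.
Qed.

End factorial_bounds.

(** * The radii, their product and the interlacing sequence *)

Section annulus_radii.
Context {R : realType}.
Implicit Types r : R.

Definition annulus_radius r (m j : nat) : R := r * Num.sqrt (j%:R / m%:R).

Lemma annulus_radius0 r m : annulus_radius r m 0 = 0.
Proof. by rewrite /annulus_radius mul0r sqrtr0 mulr0. Qed.

Lemma annulus_radius_last r m : (0 < m)%N -> annulus_radius r m m = r.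
Proof. by move=> m0; rewrite /annulus_radius divff ?sqrtr1 ?mulr1// pnatr_eq0 -lt0n. Qed.

Lemma annulus_radius_sqr r m j : annulus_radius r m j ^+ 2 = r ^+ 2 * (j%:R / m%:R).
Proof. by rewrite exprMn sqr_sqrtr. Qed.

Lemma annulus_radius_lt r m i j : 0 < r -> (0 < m)%N ->
  (annulus_radius r m i < annulus_radius r m j) = (i < j)%N.
Proof.
move=> r0 m0; have m1 : 0 < m%:R :> R by rewrite ltr0n.
rewrite -(@ltr_pXn2r _ 2%N) ?nnegrE ?mulr_ge0 ?(ltW r0)// !annulus_radius_sqr.
by rewrite ltr_pM2l ?exprn_gt0// ltr_pM2r ?invr_gt0// ltr_nat.
Qed.

Lemma prod_annulus_radius_sqr r m :
  (\prod_(j < m) annulus_radius r m j.+1) ^+ 2 = (r ^+ 2) ^+ m * m`!%:R / m%:R ^+ m.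
Proof.
rewrite -prodrXl; under eq_bigr do rewrite annulus_radius_sqr.
rewrite big_split/= prodr_const card_ord big_split/= prodr_const card_ord exprVn mulrA.
by rewrite fact_prod big_add1/= big_mkord natr_prod.
Qed.

(** The inequality stays strict at the threshold thanks to [exprn_lt_expR_fact]; this leaves room to
    shrink the radii. *)
Lemma prod_annulus_radius_gt1 r m : expR (1 / 2) <= r -> (0 < m)%N ->
  1 < \prod_(j < m) annulus_radius r m j.+1.
Proof.
move=> er m0; have m1 : 0 < m%:R :> R by rewrite ltr0n.
have r0 : 0 < r by exact: lt_le_trans (expR_gt0 _) er.
rewrite -(@ltr_pXn2r _ 2%N)// ?nnegrE//; last first.
  by apply: prodr_ge0 => i _; rewrite mulr_ge0// ltW.
rewrite expr1n prod_annulus_radius_sqr ltr_pdivlMr ?exprn_gt0// mul1r.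
apply: lt_le_trans (exprn_lt_expR_fact m0) _.
rewrite ler_pM2r ?ltr0n ?fact_gt0// -[X in expR X]mulr1 expRM_natl.
rewrite lerXn2r ?nnegrE ?expR_ge0 ?exprn_ge0 ?(ltW r0)//.
have -> : expR 1 = expR (1 / 2) ^+ 2 :> R by rewrite -expRM_natl; congr expR; lra.
by rewrite lerXn2r ?nnegrE ?expR_ge0 ?(ltW r0).
Qed.

(** Take [sigma j = c * tau (j + 1)] with [c < 1] close to 1: finitely many strict inequalities that
    hold at [c = 1] persist nearby. *)
Lemma interlacing_sigma r m : expR (1 / 2) <= r -> (0 < m)%N ->
  exists sigma : nat -> R,
    (forall j, (j < m)%N -> annulus_radius r m j < sigma j < annulus_radius r m j.+1)
    /\ 1 <= \prod_(0 <= j < m) sigma j.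
Proof.
move=> er m0; have r0 : 0 < r by exact: lt_le_trans (expR_gt0 _) er.
set t := annulus_radius r m; set Q := \prod_(j < m) t j.+1.
have Q1 : 1 < Q by exact: prod_annulus_radius_gt1.
suff [c [c1 cQ ct]] : exists c, [/\ c < 1, 1 < c ^+ m * Q
    & forall j : 'I_m, t j < c * t j.+1].
  exists (fun j => c * t j.+1); split=> [j jm|].
    rewrite (ct (Ordinal jm))/=/= gtr_pMl//.
    by rewrite -(annulus_radius0 r m) annulus_radius_lt.
  by rewrite big_mkord big_split/= prodr_const card_ord ltW.
have h1 : \forall c \near (1 : R)^'-, 1 < c ^+ m * Q.
  apply: (@cvgr_gt _ _ _ _ (fun c => c ^+ m * Q) (1 ^+ m * Q)).
    apply: cvg_at_left_filter; apply: cvgM; last exact: cvg_cst.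
    exact: exprn_continuous.
  by rewrite expr1n mul1r.
have h2 : \forall c \near (1 : R)^'-, forall j : 'I_m, t j < c * t j.+1.
  apply: filter_forall => j; apply: (@cvgr_gt _ _ _ _ (fun c => c * t j.+1) (1 * t j.+1)).
    by apply: cvg_at_left_filter; apply: cvgM; [exact: cvg_id|exact: cvg_cst].
  by rewrite mul1r annulus_radius_lt.
have h3 : \forall c \near (1 : R)^'-, c < 1 by exact: nbhs_left_lt.
have [c [? [? ?]]] := filter_ex (filterI h3 (filterI h1 h2)).
by exists c.
Qed.

End annulus_radii.

(** * Conjugates on circles *)

Section cis.
Context {R : realType}.
Implicit Types a b : R.

Definition cis a : R[i] := cos a +i* sin a.

Lemma cis0 : cis 0 = 1. Proof. by rewrite /cis cos0 sin0. Qed.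

Lemma cisD a b : cis (a + b) = cis a * cis b.
Proof. by rewrite /cis cosD sinD; simpc; congr (_ +i* _); ring. Qed.

Lemma cisX a k : cis a ^+ k = cis (k%:R * a).
Proof.
elim: k => [|k ih]; first by rewrite expr0 mul0r cis0.
by rewrite exprS ih -cisD -natr1; congr cis; ring.
Qed.

Lemma normc_cis a : Normc.normc (cis a) = 1.
Proof. by rewrite /= cos2Dsin2 sqrtr1. Qed.

Lemma cis_neq0 a : cis a != 0.
Proof.
apply/eqP => c0; have := normc_cis a; rewrite c0 Normc.normc0 => /eqP.
by rewrite eq_sym oner_eq0.
Qed.

Lemma cis_eq1 a : 0 <= a < pi * 2 -> cis a = 1 -> a = 0.
Proof.
move=> /andP[a0 a2] [+ _]; move: a0; rewrite le_eqVlt => /orP[/eqP//|a0].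
have s0 : 0 < sin (a / 2) by apply: sin_gt0_pi; lra.
have -> : a = a / 2 + a / 2 by lra.
by rewrite cosD; have := cos2Dsin2 (a / 2); nra.
Qed.

Definition unit_root N : R[i] := cis (pi * 2 / N%:R).

Lemma unit_root_expr N : (0 < N)%N -> unit_root N ^+ N = 1.
Proof.
move=> N0; rewrite cisX mulrC divfK ?pnatr_eq0 -?lt0n//.
by rewrite /cis mulr_natr cos2pi sin2pi.
Qed.

(** For [i <= j], the quotient of the two powers is [cis] of an angle in [[0, 2 pi)], so [cis_eq1]
    applies. *)
Lemma unit_root_inj N i j : (i < N)%N -> (j < N)%N ->
  unit_root N ^+ i = unit_root N ^+ j -> i = j.
Proof.
wlog : i j / (i <= j)%N.
  by move=> h iN jN; have [ij|/ltnW ji] := leqP i j; [|move=> /esym];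
    move=> /h-> .
move=> ij iN jN.
have N0 : 0 < N%:R :> R by rewrite ltr0n (leq_ltn_trans _ iN).
rewrite -{1}(subnK ij) exprD -[X in X = _]mul1r => /mulIf.
rewrite expf_neq0 ?cis_neq0// => /(_ isT)/esym; rewrite cisX => /cis_eq1.
have d0 : 0 <= (j - i)%:R * ((pi : R) * 2 / N%:R) < (pi : R) * 2.
  rewrite mulr_ge0 ?divr_ge0 ?mulr_ge0 ?pi_ge0//= mulrA ltr_pdivrMr// mulrC.
  by rewrite ltr_pM2l ?mulr_gt0 ?pi_gt0// ltr_nat (leq_ltn_trans (leq_subr _ _)).
move=> /(_ d0)/eqP; rewrite mulf_eq0 pnatr_eq0 subn_eq0 => /orP[ji|].
  by apply/eqP; rewrite eqn_leq ij.
by rewrite gt_eqF// divr_gt0 ?mulr_gt0 ?pi_gt0.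
Qed.

Lemma XnsubX_factor N (a : R[i]) : (0 < N)%N -> a != 0 ->
  'X^N - (a ^+ N)%:P = \prod_(k <- iota 0 N) ('X - (a * unit_root N ^+ k)%:P).
Proof.
move=> N0 a0; rewrite [LHS](@all_roots_prod_XsubC _ _ [seq a * unit_root N ^+ k | k <- iota 0 N]).
- by rewrite (eqP (monicXnsubC _ _))// scale1r big_map.
- by rewrite size_XnsubC// size_map size_iota.
- apply/allP => _ /mapP[k _ ->].
  by rewrite rootE !hornerE exprMn exprAC unit_root_expr// expr1n mulr1 subrr.
- rewrite uniq_rootsE map_inj_in_uniq ?iota_uniq// => i j.
  rewrite !mem_iota !add0n/= => iN jN /(mulfI a0).
  exact: unit_root_inj.
Qed.

End cis.

(** Substituting ['X^N] only inserts zero coefficients, so Eisenstein's criterion at 2 carries over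
    from [q]. *)
Lemma eisenstein_comp_Xn (q : {poly int}) m N : (0 < m)%N -> (0 < N)%N ->
  q \is monic -> size q = m.+1 -> (forall i, (i < m)%N -> (2 %| q`_i)%Z) ->
  ~~ (2%:Z ^+ 2 %| q`_0)%Z ->
  q \Po 'X^N \is monic /\ irreducible_poly (map_poly (intr : int -> rat) (q \Po 'X^N)).
Proof.
move=> m0 N0 mq sq q2 q4.
have sX : (1 < size ('X^N : {poly int}))%N by rewrite size_polyXn ltnS.
have sQ : (size (q \Po 'X^N)).-1 = (m * N)%N by rewrite size_comp_poly sq size_polyXn.
have mQ : q \Po 'X^N \is monic.
  by rewrite monicE lead_coef_comp// lead_coefXn expr1n mulr1 (eqP mq).
split=> //; apply/irreducible_rat_int; apply: (@eisenstein_crit 2) => //.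
- have mN : (0 < m * N)%N by rewrite muln_gt0 m0.
  by case: (size _) sQ mN => [|[|k]] //= <-.
- by rewrite (eqP mQ).
- by rewrite coef_comp_poly_Xn// dvdn0 div0n.
- move=> i; rewrite sQ coef_comp_poly_Xn//; case: ifP => // _ imN.
  by apply: q2; rewrite ltn_divLR.
Qed.

Lemma exists_conjugates_on_circles {R : realType} (r : R) m :
  expR (1 / 2) <= r -> (0 < m)%N -> \forall N \near \oo,
  exists (z : R[i]) (rho : nat -> R), [/\ algebraic_integer z,
    forall j, (j < m)%N -> annulus_radius r m j < rho j < annulus_radius r m j.+1
  & perm_eq (galois_conjugates z)
      [seq (rho j)%:C * unit_root N ^+ k | j <- iota 0 m, k <- iota 0 N]].
Proof.
move=> er m0; have r0 : 0 < r by exact: lt_le_trans (expR_gt0 _) er.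
have [sigma [ts sp]] := interlacing_sigma er m0.
have H := interlacing_int_poly (annulus_radius0 r m) ts sp m0.
near=> N.
have N0 : (0 < N)%N by near: N; exact: nbhs_infty_gt.
have [q [mq sq q2 q4 [w [wP qw]]]] : exists q : {poly int}, [/\ q \is monic, size q = m.+1,
    forall i, (i < m)%N -> (2 %| q`_i)%Z, ~~ (2%:Z ^+ 2 %| q`_0)%Z
  & exists w : nat -> R, (forall j, (j < m)%N -> 
      annulus_radius r m j ^+ N < w j < annulus_radius r m j.+1 ^+ N) /\
    map_poly intr q = \prod_(j < m) ('X - (w j)%:P)] by near: N; exact: H.
have t_ge0 j : 0 <= annulus_radius r m j by rewrite mulr_ge0// ltW.
have w_gt0 j : (j < m)%N -> 0 < w j.
  by move=> /wP/andP[+ _]; apply: le_lt_trans; rewrite exprn_ge0.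
(* The positive [N]-th root of [w j]. *)
pose rho j := expR (ln (w j) / N%:R).
have rho_gt0 j : 0 < rho j by exact: expR_gt0.
have rhoX j : (j < m)%N -> rho j ^+ N = w j.
  move=> jm; rewrite -expRM_natl mulrC divfK ?pnatr_eq0 -?lt0n// lnK// posrE.
  exact: w_gt0.
have [mQ iQ] := eisenstein_comp_Xn m0 N0 mq sq q2 q4.
set Q := q \Po 'X^N in mQ iQ.
have QE : map_poly (intr : int -> R[i]) Q =
    \prod_(b <- [seq (rho j)%:C * unit_root N ^+ k | j <- iota 0 m, k <- iota 0 N])
      ('X - b%:P).
  rewrite big_allpairs_dep/= -{1}[m]subn0 -/(index_iota 0 m) big_mkord.
  have -> : map_poly intr Q = map_poly (real_complex R) (map_poly intr q) \Po 'X^N.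
    rewrite map_comp_poly map_polyXn -map_poly_comp; congr (_ \Po _).
    by apply: eq_map_poly => n; rewrite /= rmorph_int.
  rewrite qw rmorph_prod rmorph_prod/=; apply: eq_bigr => j _.
  rewrite map_polyXsubC rmorphB/= comp_polyX comp_polyC -(rhoX j (ltn_ord j)).
  rewrite rmorphXn/= XnsubX_factor//.
  by rewrite -(rmorph0 (real_complex R)) (inj_eq (@complexI R)) gt_eqF.
(* By irreducibility any root of [Q] would do; this one has [j = k = 0]. *)
exists (rho 0%N)%:C, rho.
have rQ : root (map_poly (intr : int -> R[i]) Q) (rho 0%N)%:C.
  rewrite QE root_prod_XsubC; apply/allpairsP; exists (0%N, 0%N) => /=.
  by rewrite !mem_iota/= expr0 mulr1.
have az : algebraic_integer (rho 0%N)%:C by exists Q.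
split=> //.
- by move=> j jm; have := wP j jm; rewrite -(rhoX j jm) !ltr_pXn2r ?nnegrE ?(ltW (rho_gt0 _)).
- have QC : map_poly (ratr : rat -> R[i]) (map_poly intr Q) = map_poly intr Q.
    by rewrite -map_poly_comp (eq_map_poly (fun n => rmorph_int _ n)).
  apply: prod_XsubC_eq; rewrite -galois_conjugatesE// -QE.
  by rewrite (minpolyQ_unique _ iQ) ?QC// monic_map.
Unshelve. all: by end_near. Qed.

(** * Area and rotations *)

Section lebesgue_shear.
Context {R : realType}.
Local Notation mR := (measurableTypeR R).
Local Notation leb := (@lebesgue_measure R).
Local Notation leb2 := (leb \x leb)%E.

(** Lebesgue measure is determined by its values on half-open intervals, where translation
    invariance is explicit. *)
Lemma lebesgue_measure_translate (c : R) (A : set mR) : measurable A ->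
  leb ((fun x : mR => x + c) @^-1` A) = leb A.
Proof.
move=> mA.
have mt : measurable_fun [set: mR] (fun x : mR => x + c : mR).
  by apply: (@measurable_funD _ _ _ _ (fun x => x) (cst c)).
pose mu := measure_function_pushforward__canonical__measure_function_Measure leb mt.
suff h X : ocitv X -> leb X = mu X.
  by have e := lebesgue_measure_unique h mA; rewrite e.
move=> [[a b] _ <-].
rewrite /= /pushforward (_ : _ @^-1` _ = `]a - c, b - c]%classic).
  rewrite !lebesgue_measure_itv/= !lte_fin ltrD2r; case: ifP => // _.
  by rewrite -!EFinB; congr EFin; ring.
by apply/seteqP; split=> x /=; rewrite !in_itv/= ltrBlDr lerBrDr.
Qed.

(* A plane rotation is a product of three shears, each of which preserves area by
   Fubini and translation invariance. *)
Definition vshear (t : R) (p : mR * mR) : mR * mR := (p.1, p.2 + t * p.1).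
Definition hshear (t : R) (p : mR * mR) : mR * mR := (p.1 + t * p.2, p.2).

Lemma measurable_vshear t : measurable_fun setT (vshear t).
Proof.
apply/measurable_fun_pairP; split; first exact: measurable_fst.
apply: (@measurable_funD _ _ R setT (fun p : mR * mR => p.2) (fun p => t * p.1)).
  exact: measurable_snd.
by apply: (@measurable_funM _ _ R setT (cst t)) => //; exact: measurable_fst.
Qed.

Lemma measurable_hshear t : measurable_fun setT (hshear t).
Proof.
apply/measurable_fun_pairP; split; last exact: measurable_snd.
apply: (@measurable_funD _ _ R setT (fun p : mR * mR => p.1) (fun p => t * p.2)).
  exact: measurable_fst.
by apply: (@measurable_funM _ _ R setT (cst t)) => //; exact: measurable_snd.
Qed.

(** The section over [x] of the preimage is the section of [A] translated by [t * x]. *)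
Lemma leb2_vshear t A : measurable A -> leb2 (vshear t @^-1` A) = leb2 A.
Proof.
move=> mA; rewrite /product_measure1; apply: eq_integral => x _ /=.
rewrite -[RHS](lebesgue_measure_translate (t * x)); last exact: measurable_xsection.
by congr leb; apply/seteqP; split=> y; rewrite /xsection/= !inE.
Qed.

Lemma leb2_hshear t A : measurable A -> leb2 (hshear t @^-1` A) = leb2 A.
Proof.
move=> mA.
have mhA : measurable (hshear t @^-1` A).
  by rewrite -[X in measurable X]setTI; exact: measurable_hshear.
(* A horizontal shear translates horizontal sections, so the order of integration is exchanged
   first. *)
have e B : measurable B -> leb2 B = product_measure2 leb leb B.
  move=> mB; apply: product_measure_unique => // C D mC mD.
  exact: product_measure2E.
rewrite !e// /product_measure2; apply: eq_integral => y _ /=.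
rewrite -[RHS](lebesgue_measure_translate (t * y)); last exact: measurable_ysection.
by congr leb; apply/seteqP; split=> x; rewrite /ysection/= !inE.
Qed.

End lebesgue_shear.

(** * Rotation invariance and masses of disks *)

Section borel_plane.
Context {R : realType}.

Lemma open_measurableC (A : set R[i]) : open A -> measurable A.
Proof. by move=> oA; exact: sub_sigma_algebra. Qed.

Lemma continuous_measurableC (f : R[i] -> R) : continuous f -> measurable_fun setT f.
Proof.
move=> /continuousP cf; apply: (measurability _ (RGenOpens.measurableE R)) => //.
move=> _ [_ [a [b ->] <-]]; rewrite setTI; apply: open_measurableC.
exact/cf/interval_open.
Qed.

Lemma measurable_mulC (u : R[i]) : measurable_fun setT (fun z : R[i] => u * z).
Proof.
apply: (@measurability _ _ _ _ _ _ (@open R[i])) => // _ [U oU <-].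
rewrite setTI; apply: open_measurableC; move: U oU; apply/continuousP.
exact: mulrl_continuous.
Qed.

(* [t] is the tangent of half the angle, hence [s * t = 1 - c]. *)
Let of_plane_shears (c s : R) : c ^+ 2 + s ^+ 2 = 1 -> c != -1 ->
  let t := s / (1 + c) in
  forall p, of_plane (hshear (- t) (vshear s (hshear (- t) p))) =
            (c +i* s) * of_plane p.
Proof.
move=> cs c1 /= [x y]; rewrite /of_plane /hshear /vshear/=; simpc.
have d0 : 1 + c != 0 by rewrite addrC addr_eq0.
set t := s / (1 + c).
have tc : t * (1 + c) = s by rewrite divfK.
have st : s * t = 1 - c.
  by apply: (mulIf d0); rewrite -mulrA tc -expr2 -[LHS](addKr (c ^+ 2)) cs; ring.
congr (_ +i* _).
  transitivity (x * (1 - s * t) - t * (2 - s * t) * y); first by ring.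
  by rewrite st -[X in _ = _ - X * _]tc; ring.
transitivity (s * x + (1 - s * t) * y); first by ring.
by rewrite st; ring.
Qed.

Lemma area_rotation (u : R[i]) (A : set R[i]) : Normc.normc u = 1 -> measurable A ->
  area ((fun z => u * z) @^-1` A) = area A.
Proof.
move=> u1 mA.
have key (c s : R) (B : set R[i]) : c ^+ 2 + s ^+ 2 = 1 -> c != -1 -> measurable B ->
    area ((fun z => (c +i* s) * z) @^-1` B) = area B.
  move=> cs c1 mB; rewrite /area /pushforward.
  have mB' : measurable (@of_plane R @^-1` B).
    by rewrite -[X in measurable X]setTI; exact: measurable_of_plane.
  set t := s / (1 + c).
  have mh C : measurable C -> measurable (hshear (- t) @^-1` C).
    by move=> mC; rewrite -[X in measurable X]setTI; exact: measurable_hshear.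
  have mv C : measurable C -> measurable (vshear s @^-1` C).
    by move=> mC; rewrite -[X in measurable X]setTI; exact: measurable_vshear.
  apply: etrans (leb2_hshear (- t) mB').
  apply: etrans (leb2_vshear s (mh _ mB')).
  apply: etrans (leb2_hshear (- t) (mv _ (mh _ mB'))).
  congr (_ \x _)%E; apply/seteqP; split => p /=;
    by rewrite (of_plane_shears cs c1).
have : (complex.Re u) ^+ 2 + (complex.Im u) ^+ 2 = 1.
  case: u u1 => a b /= ab; have := sqr_sqrtr (addr_ge0 (sqr_ge0 a) (sqr_ge0 b)).
  by rewrite ab expr1n.
(* The half turn, whose half-angle tangent is infinite, is the square of the rotation by
   [0 +i* 1]. *)
case: u {u1} => c s /= cs; have [c1|c1] := eqVneq c (-1); last exact: key.
have i1 : (0 : R) ^+ 2 + 1 ^+ 2 = 1 by rewrite expr0n expr1n add0r.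
have i2 : (0 : R) != -1 by rewrite eq_sym oppr_eq0 oner_neq0.
have s0 : s = 0 by apply/eqP; rewrite -sqrf_eq0; apply/eqP; move: cs; rewrite c1 sqrrN expr1n; lra.
have miA : measurable ((fun z : R[i] => (0 +i* 1) * z) @^-1` A).
  by rewrite -[X in measurable X]setTI; exact: measurable_mulC.
apply: etrans (key 0 1 A i1 i2 mA); apply: etrans (key 0 1 _ i1 i2 miA).
by congr area; apply/seteqP; split => -[x y] /=; rewrite c1 s0; simpc.
Qed.

Variables (r : R) (r0 : 0 < r).

Lemma disk_uniformE (A : set R[i]) :
  disk_uniform r0 A = ((pi * r ^+ 2)^-1%:E * area (A `&` disk r))%E.
Proof. by []. Qed.

Lemma disk_uniform_rotation (u : R[i]) (A : set R[i]) : Normc.normc u = 1 -> measurable A ->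
  disk_uniform r0 ((fun z => u * z) @^-1` A) = disk_uniform r0 A.
Proof.
move=> u1 mA; rewrite !disk_uniformE; congr (_ * _)%E.
rewrite -[RHS](area_rotation u1); last by apply: measurableI => //; exact: measurable_disk.
have nu : `|u| = 1 by exact: (congr1 (real_complex R) u1).
by congr area; apply/seteqP; split => z; rewrite /disk/= normrM nu mul1r.
Qed.

Lemma disk_uniform_disk (s : R) : 0 <= s <= r -> disk_uniform r0 (disk s) = (s ^+ 2 / r ^+ 2)%:E.
Proof.
move=> /andP[s0 sr]; rewrite disk_uniformE.
have -> : disk s `&` disk r = disk s.
  by apply/setIidl => z /= zs; rewrite /disk/= (lt_le_trans zs)// lecR.
have pi0 := pi_gt0 R.
move: s0; rewrite le_eqVlt => /orP[/eqP<-|s0].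
  rewrite (_ : disk 0 = set0) ?measure0 ?mule0 ?expr0n ?mul0r//.
  by apply/seteqP; split => // z /= z0; have := le_lt_trans (normr_ge0 z) z0; rewrite ltxx.
rewrite area_disk// -EFinM; congr EFin; move: (pi : R) pi0 => p p0; field.
by rewrite (gt_eqF r0) (gt_eqF p0).
Qed.

End borel_plane.

(** * Integrals bounded by sums over annuli *)

Section disk_integral.
Context {R : realType}.
Variables (r : R) (r0 : 0 < r).

Lemma disk_uniform_annulus m j : (j < m)%N ->
  disk_uniform r0 (disk (annulus_radius r m j.+1) `\` disk (annulus_radius r m j)) = (m%:R^-1)%:E.
Proof.
move=> jm; have m0 := leq_ltn_trans (leq0n j) jm.
have m1 : 0 < m%:R :> R by rewrite ltr0n.
have t_ge0 i : 0 <= annulus_radius r m i by rewrite mulr_ge0// ltW.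
have t_le i : (i <= m)%N -> annulus_radius r m i <= r.
  move=> im; rewrite -[leRHS](annulus_radius_last r m0).
  by move: im; rewrite leq_eqVlt => /orP[/eqP->//|im]; rewrite ltW// annulus_radius_lt.
have ttj : annulus_radius r m j <= annulus_radius r m j.+1 by rewrite ltW// annulus_radius_lt.
rewrite measureD; [|exact: measurable_disk|exact: measurable_disk|]; last first.
  by rewrite (le_lt_trans (probability_le1 _ _)) ?ltry//; exact: measurable_disk.
rewrite (_ : disk _ `&` disk _ = disk (annulus_radius r m j)); last first.
  by apply/setIidr => z /= zs; rewrite /disk/= (lt_le_trans zs)// lecR.
rewrite /= !disk_uniform_disk ?t_ge0 ?t_le// ?(ltnW jm)// -EFinB !annulus_radius_sqr.
congr EFin; rewrite -natr1; field.
by rewrite (gt_eqF r0) (gt_eqF m1).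
Qed.

(** An upper sum over annuli of mass [1 / m], obtained by adding one annulus at a time. Lower bounds
    follow by applying it to [- g]. *)
Lemma disk_integral_le m (g : R[i] -> R) (c : nat -> R) : (0 < m)%N ->
  measurable_fun setT g -> [bounded g x | x in setT] ->
  (forall j z, (j < m)%N ->
    annulus_radius r m j <= Normc.normc z < annulus_radius r m j.+1 -> g z <= c j) ->
  (\int[disk_uniform r0]_z (g z)%:E <= (m%:R^-1 * \sum_(j < m) c j)%:E)%E.
Proof.
move=> m0 mg bg gc.
have t_ge0 i : 0 <= annulus_radius r m i by rewrite mulr_ge0// ltW.
have ig (A : set R[i]) : measurable A -> (disk_uniform r0).-integrable A (EFin \o g).
  move=> mA; apply: measurable_bounded_integrable => //.
  - by rewrite (le_lt_trans (probability_le1 _ mA))// ltry.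
  - exact: measurable_funTS.
  - by case: bg => M [Mr MP]; exists M; split=> // x Mx y _; exact: MP.
have mD s : measurable (disk s : set R[i]) by exact: measurable_disk.
have step n : (n <= m)%N ->
    (\int[disk_uniform r0]_(z in disk (annulus_radius r m n)) (g z)%:E
      <= (m%:R^-1 * \sum_(j < n) c j)%:E)%E.
  elim: n => [_|n ih nm].
    rewrite big_ord0 mulr0 annulus_radius0 (_ : disk 0 = set0) ?integral_set0//.
    by apply/seteqP; split => // z /= z0; have := le_lt_trans (normr_ge0 z) z0; rewrite ltxx.
  have ttj : annulus_radius r m n <= annulus_radius r m n.+1 by rewrite ltW// annulus_radius_lt.
  have sub : disk (annulus_radius r m n) `<=` disk (annulus_radius r m n.+1).
    by move=> z /= zs; rewrite /disk/= (lt_le_trans zs)// lecR.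
  rewrite -(setDUK sub) integral_setU//; last 3 first.
  - exact: measurableD.
  - exact/measurable_EFinP/measurable_funTS.
  - by apply/disj_setPRL => z [].
  rewrite big_ord_recr/= mulrDr EFinD leeD// ?ih ?(ltnW nm)//.
  have mA : measurable (disk (annulus_radius r m n.+1) `\` disk (annulus_radius r m n) : set R[i]).
    exact: measurableD.
  apply: (@le_trans _ _ (\int[disk_uniform r0]_(z in disk (annulus_radius r m n.+1)
     `\` disk (annulus_radius r m n)) (c n)%:E)%E).
    apply: le_integral => //; first exact: ig.
      exact: finite_measure_integrable_cst.
    move=> z; rewrite inE => -[/= z1 z2]; rewrite lee_fin; apply: gc => //.
    move: z1 z2; rewrite /disk/= -[`|z|]/((Normc.normc z)%:C) !ltcR => z1 /negP.
    by rewrite -leNgt => ->.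
  by rewrite integral_cst//= disk_uniform_annulus// -EFinM mulrC.
apply: le_trans (step m (leqnn m)); rewrite annulus_radius_last//.
(* The complement of the disk is a null set. *)
rewrite (negligible_integral (measurableC (mD r)))//; last first.
- by rewrite /= disk_uniformE setICl measure0 mule0.
- exact: ig.
by rewrite setDE setCK setTI.
Qed.

End disk_integral.

(** * Test functions *)

Section conjugate_average.
Context {R : realType}.
Implicit Types (z : R[i]) (f g : R[i] -> R).

Let ge0_integral_conjugate_measure z g : measurable_fun setT g ->
  (forall x, 0 <= g x) -> (\int[conjugate_measure z]_x (g x)%:E =
  ((algdegree z)%:R^-1 * \sum_(b <- galois_conjugates z) g b)%:E)%E.
Proof.
move=> mg g0; have mg' : measurable_fun setT (EFin \o g) by exact/measurable_EFinP.
rewrite ge0_integral_mscale//; last by move=> x _; rewrite lee_fin.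
rewrite ge0_integral_measure_sum//; last by move=> x _; rewrite lee_fin.
rewrite EFinM; congr (_ * _)%E.
under eq_bigr do rewrite integral_dirac// diracT mul1e.
by rewrite (big_nth 0) big_mkord sumEFin.
Qed.

Lemma integral_conjugate_measure z f : measurable_fun setT f ->
  (\int[conjugate_measure z]_x (f x)%:E =
  ((algdegree z)%:R^-1 * \sum_(b <- galois_conjugates z) f b)%:E)%E.
Proof.
move=> mf; rewrite integralE.
pose fp x := Num.max (f x) 0; pose fn x := Num.max (- f x) 0.
have -> : (\int[conjugate_measure z]_x (fun x => (f x)%:E)^\+ x = 
    \int[conjugate_measure z]_x (fp x)%:E)%E.
  by apply: eq_integral => x _; rewrite funeposE EFin_max.
have -> : (\int[conjugate_measure z]_x (fun x => (f x)%:E)^\- x = 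
    \int[conjugate_measure z]_x (fn x)%:E)%E.
  by apply: eq_integral => x _; rewrite funenegE EFin_max.
rewrite !ge0_integral_conjugate_measure.
- rewrite -EFinB -mulrBr -sumrB; congr (_ * _)%:E; apply: eq_bigr => b _.
  by rewrite /fp /fn; case: (leP (f b) 0) => fb; case: (leP (- f b) 0) => fb'; lra.
- exact: measurable_funrneg.
- by move=> x; rewrite le_max lexx orbT.
- exact: measurable_funrpos.
- by move=> x; rewrite le_max lexx orbT.
Qed.

End conjugate_average.

(** * Boundedness and uniform continuity of test functions *)

Section compact_support.
Context {R : realType}.
Variable f : R[i] -> R.
Hypotheses (cf : continuous f) (kf : compact (closure [set z | f z != 0])).

Let out z : ~ closure [set z | f z != 0] z -> f z = 0.
Proof. by move=> zK; apply/eqP/negPn/negP => fz; apply: zK; exact: subset_closure. Qed.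

Lemma compact_support_bounded : [bounded f x | x in setT].
Proof.
have /compact_bounded : compact (f @` closure [set z | f z != 0]).
  by apply: continuous_compact => //; exact: continuous_subspaceT.
move=> [M [Mr MP]]; exists (Num.max M 0); split; first exact: num_real.
move=> x; rewrite gt_max => /andP[Mx x0] z _ /=.
have [zK|/out ->] := pselect (closure [set z | f z != 0] z).
  by apply: (MP x Mx); exists z.
by rewrite normr0 ltW.
Qed.

(** Compactness gives one [d] for all [z] in the support and arbitrary [w]. The remaining pairs are
    treated by exchanging [z] and [w], or because both values vanish. *)
Lemma compact_support_uniform (e : R) : 0 < e -> exists2 d : R, 0 < d &
  forall z w, Normc.normc (z - w) < d -> `|f z - f w| < e.
Proof.
move=> e0; set K := closure [set z | f z != 0].
have cov : \forall d \near (0 : R)^'+, K `<=` (fun z =>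
    forall w, Normc.normc (z - w) < d -> `|f z - f w| < e).
  move/compact_near_coveringP : kf; apply => z0 _.
  have e2 : 0 < e / 2 by rewrite divr_gt0.
  have /cvgrPdist_lt/(_ _ e2) := @cf z0.
  rewrite -nbhs_ballE => -[d0 /= d0_gt0 dP].
  have d0E : d0 = (complex.Re d0)%:C by rewrite RRe_real// gtr0_real.
  move: d0E d0_gt0 dP; move: (complex.Re d0) => d -> {d0}; rewrite ltcR => d0 dP.
  exists (ball z0 (d / 2)%:C, [set x | x < d / 2]) => /=.
    split; first by apply: nbhsx_ballx; rewrite ltcR divr_gt0.
    by apply: nbhs_right_lt; rewrite divr_gt0.
  move=> [z x] /= [z0z xd] w zw.
  have h1 : `|f z0 - f z| < e / 2.
    apply: dP; apply: lt_trans z0z _; rewrite ltcR; lra.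
  have h2 : `|f z0 - f w| < e / 2.
    apply: dP; rewrite /ball/=; apply: le_lt_trans (ler_distD z _ _) _.
    have -> : d = d / 2 + d / 2 by lra.
    rewrite rmorphD/= ltrD// -[`|_|]/((Normc.normc _)%:C) ltcR.
    exact: lt_trans zw _.
  have := ler_distD (f z0) (f z) (f w); rewrite (distrC (f z) (f z0)); lra.
have [d [d0 dP]] := filter_ex (filterI (nbhs_right_gt (0 : R)) cov).
exists d => // z w zw; have [zK|zK] := pselect (K z); first exact: dP.
have [wK|wK] := pselect (K w).
  by rewrite distrC; apply: (dP w wK); rewrite -normcN opprB.
by rewrite (out zK) (out wK) subrr normr0.
Qed.

End compact_support.

(** * Averages over rotations *)

Section rotation_average.
Context {R : realType}.
Implicit Types (z u : R[i]) (f : R[i] -> R) (N : nat).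

Lemma cis_near1 (e : R) : 0 < e ->
  exists2 d : R, 0 < d & forall a, `|a| < d -> Normc.normc (cis a - 1) < e.
Proof.
move=> e0; have e2 : 0 < e / 2 by rewrite divr_gt0.
have /cvgrPdist_lt/(_ _ e2) := @continuous_cos R 0.
have /cvgrPdist_lt/(_ _ e2) := @continuous_sin R 0.
move=> hs hc; have := filterI hs hc; rewrite -nbhs_ballE => -[d /= d0 dP].
exists d => // a ad; have [] := dP a.
  by rewrite /ball/= sub0r normrN.
rewrite sin0 cos0 sub0r normrN => sa ca.
have := norm_of_plane_le (cos a - 1) (sin a).
rewrite -[X in X <= _]/((Normc.normc _)%:C) lecR/= => h; rewrite subr0.
by apply: le_lt_trans h _; rewrite distrC; lra.
Qed.

Lemma polar z : exists2 a : R, - pi <= a <= pi & z = (Normc.normc z)%:C * cis a.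
Proof.
have pi0 := pi_ge0 R.
have [->|z0] := eqVneq z 0.
  by exists 0; [lra|rewrite Normc.normc0 mul0r].
case: z z0 => x y z0; set n := Normc.normc _.
have n0 : 0 < n.
  rewrite lt_neqAle sqrtr_ge0 andbT eq_sym; apply: contra_neq z0.
  exact: Normc.eq0_normc.
have nE : n ^+ 2 = x ^+ 2 + y ^+ 2 by rewrite sqr_sqrtr// addr_ge0 ?sqr_ge0.
have c1 : -1 <= x / n <= 1.
  rewrite -ler_norml normrM normfV (gtr0_norm n0) ler_pdivrMr// mul1r.
  by rewrite -[leRHS](gtr0_norm n0) -ler_sqr ?nnegrE// !real_normK ?num_real// nE lerDl sqr_ge0.
have [/andP[a0 api] ca] := acos_def c1.
have sa : sin (acos (x / n)) = `|y / n|.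
  rewrite sin_acos// -sqrtr_sqr; congr Num.sqrt.
  apply: (mulIf (_ : n ^+ 2 != 0)); first by rewrite expf_neq0 ?gt_eqF.
  by rewrite mulrBl -!exprMn !divfK ?gt_eqF// mul1r nE; ring.
have [y0|y0] := leP 0 y.
  exists (acos (x / n)); first by rewrite api andbT; lra.
  rewrite /cis ca sa ger0_norm ?divr_ge0 ?(ltW n0)//; simpc.
  by rewrite ![n * _]mulrC !divfK ?gt_eqF.
exists (- acos (x / n)); first lra.
rewrite /cis cosN sinN ca sa normrM (ltr0_norm y0) normfV (gtr0_norm n0) mulNr opprK; simpc.
by rewrite ![n * _]mulrC !divfK ?gt_eqF.
Qed.

(** Some multiple of the angle [2 pi / N] brings the argument of [z] within [2 pi / N] of a full
    turn. The remaining error is proportional to the modulus, so [N] does not depend on [z]. *)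
Lemma rotate_near_real (e : R) : 0 < e -> \forall N \near \oo, forall z, exists l,
  Normc.normc (z * unit_root N ^+ l - (Normc.normc z)%:C) <= e * Normc.normc z.
Proof.
move=> e0; have [d d0 dP] := cis_near1 e0.
have pi0 := pi_gt0 R.
near=> N => z.
have N0 : 0 < N%:R :> R by rewrite ltr0n; near: N; exact: nbhs_infty_gt.
have Nd : pi * 2 / N%:R < d.
  rewrite ltr_pdivrMr// -ltr_pdivrMl//; near: N; exact: nbhs_infty_gtr.
have [a /andP[a1 a2] zE] := polar z.
(* The exact number of steps of angle [2 pi / N] from [a] to [2 pi]. Aiming at [2 pi] rather than 0
   makes it nonnegative. *)
pose x := N%:R * (pi * 2 - a) / (pi * 2).
have x0 : 0 <= x by rewrite divr_ge0 ?mulr_ge0 ?(ltW N0)//; lra.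
exists (Num.truncn x).
have /andP[lx xl] := truncn_itv x0; set l := Num.truncn x in lx xl *.
rewrite [X in X * _]zE -mulrA cisX -cisD.
pose b := a + l%:R * (pi * 2 / N%:R) - pi * 2.
have -> : cis (a + l%:R * (pi * 2 / N%:R)) = cis b.
  rewrite /b [RHS]cisD -[LHS]mulr1; congr (_ * _).
  by rewrite /cis cosN sinN mulr_natr cos2pi sin2pi oppr0.
have bd : `|b| < d.
  apply: le_lt_trans Nd; rewrite ler_norml.
  have xE : x * (pi * 2 / N%:R) = pi * 2 - a.
    by rewrite /x; move: (pi : R) pi0 => p p0; field; rewrite (gt_eqF N0) (gt_eqF p0).
  have q0 : 0 < (pi : R) * 2 / N%:R by rewrite divr_gt0// mulr_gt0.
  rewrite /b; move: (pi * 2 / N%:R) q0 xE => q q0 xE.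
  have h1 : l%:R * q <= x * q by rewrite ler_pM2r.
  have h2 : x * q <= l.+1%:R * q by rewrite ler_pM2r// ltW.
  by move: h2; rewrite -natr1 mulrDl mul1r => h2; apply/andP; split; lra.
rewrite -{2}[(Normc.normc z)%:C]mulr1 -mulrBr Normc.normcM mulrC.
rewrite (_ : Normc.normc (Normc.normc z)%:C = Normc.normc z); last first.
  by rewrite /= expr0n/= addr0 sqrtr_sqr ger0_norm//; case: (z) => *; exact: sqrtr_ge0.
by rewrite ler_wpM2r ?(ltW (dP _ bd))//; case: (z) => *; exact: sqrtr_ge0.
Unshelve. all: by end_near. Qed.

Variables (r : R) (r0 : 0 < r).
Local Notation mu := (disk_uniform r0).

Lemma disk_integrable f : measurable_fun setT f -> [bounded f x | x in setT] ->
  mu.-integrable setT (EFin \o f).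
Proof.
move=> mf bf; apply: measurable_bounded_integrable => //.
by rewrite (le_lt_trans (probability_le1 _ _))// ltry.
Qed.

Lemma disk_integral_rotation f u : measurable_fun setT f -> [bounded f x | x in setT] ->
  Normc.normc u = 1 -> (\int[mu]_z (f (u * z))%:E = \int[mu]_z (f z)%:E)%E.
Proof.
move=> mf bf u1.
have mu_ := measurable_mulC u.
have mfu : measurable_fun setT (fun z => f (u * z)) by exact: measurableT_comp.
have bfu : [bounded f (u * x) | x in setT].
  by case: bf => M [Mr MP]; exists M; split=> // x Mx y _; exact: (MP x Mx).
have ifu : mu.-integrable ((fun z => u * z) @^-1` setT) ((EFin \o f) \o (fun z => u * z)).
  by rewrite preimage_setT; exact: (disk_integrable mfu bfu).
have mEf : measurable_fun setT (EFin \o f) by exact/measurable_EFinP.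
have e := integral_pushforward mu_ mEf ifu measurableT.
rewrite preimage_setT in e; rewrite -[LHS]e.
by apply: eq_measure_integral => A mA _; exact: disk_uniform_rotation.
Qed.

(** At [z = rho j] this is the mean of [f] over the conjugates on the [j]-th circle. *)
Definition rotation_average N f z := N%:R^-1 * \sum_(k < N) f (unit_root N ^+ k * z).

Lemma normc_unit_rootX N k : Normc.normc (unit_root N ^+ k : R[i]) = 1.
Proof. by rewrite cisX normc_cis. Qed.

Lemma measurable_rotation_average N f : measurable_fun setT f ->
  measurable_fun setT (rotation_average N f).
Proof.
move=> mf; apply: measurable_funM => //; apply: measurable_sum => k.
by apply: measurableT_comp => //; exact: measurable_mulC.
Qed.

Lemma bounded_rotation_average N f : (0 < N)%N -> [bounded f x | x in setT] ->
  [bounded rotation_average N f x | x in setT].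
Proof.
move=> N0 [M [Mr MP]]; exists M; split=> // x Mx z _ /=.
have N1 : 0 < N%:R :> R by rewrite ltr0n.
rewrite /rotation_average normrM normfV (gtr0_norm N1) ler_pdivrMl//.
apply: le_trans (ler_norm_sum _ _ _) _.
rewrite mulr_natl -[N in leRHS]card_ord -sumr_const; apply: ler_sum => k _.
exact: (MP x Mx).
Qed.

Lemma integral_rotation_average N f : (0 < N)%N ->
  measurable_fun setT f -> [bounded f x | x in setT] ->
  (\int[mu]_z (rotation_average N f z)%:E = \int[mu]_z (f z)%:E)%E.
Proof.
move=> N0 mf bf; have N1 : N%:R != 0 :> R by rewrite pnatr_eq0 -lt0n.
have ik (k : 'I_N) : mu.-integrable setT (fun z => (f (unit_root N ^+ k * z))%:E).
  apply: (@disk_integrable (fun z => f (unit_root N ^+ k * z))).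
    by apply: measurableT_comp => //; exact: measurable_mulC.
  by case: bf => M [Mr MP]; exists M; split=> // x Mx y _; exact: (MP x Mx).
under eq_integral do rewrite EFinM -sumEFin.
rewrite integralZl//; last exact: integrable_sum.
rewrite integral_sum//.
have /fineK fE : (\int[mu]_z (f z)%:E)%E \is a fin_num.
  exact: integrable_fin_num (disk_integrable mf bf).
under eq_bigr do rewrite disk_integral_rotation ?normc_unit_rootX// -fE.
by rewrite -fE sumEFin -EFinM sumr_const card_ord -[X in _ * X]mulr_natl mulKf.
Qed.

Lemma rotation_average_unit_root N f l z : (0 < N)%N ->
  rotation_average N f (unit_root N ^+ l * z) = rotation_average N f z.
Proof.
move=> N0; elim: l z => [|l ih] z; first by rewrite expr0 mul1r.
rewrite exprSr -mulrA ih /rotation_average; congr (_ * _).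
case: N N0 {ih} => // N _.
(* One further rotation permutes the terms cyclically: the last one becomes the first. *)
rewrite big_ord_recr [RHS]big_ord_recl/= addrC; congr (_ + _).
  by rewrite mulrA -exprSr unit_root_expr// expr0.
by apply: eq_bigr => k _; rewrite mulrA -exprSr.
Qed.

End rotation_average.

(** * Sufficiency *)

Section sufficiency.
Context {R : realType}.
Variables (r : R) (r0 : 0 < r).
Local Notation mu := (disk_uniform r0).

(** Subadditivity of the square root, applied to [j / m + 1 / m]. The bound is uniform in [j]. *)
Lemma annulus_width m j : (0 < m)%N ->
  annulus_radius r m j.+1 - annulus_radius r m j <= r / Num.sqrt m%:R.
Proof.
move=> m0; have m1 : 0 < m%:R :> R by rewrite ltr0n.
rewrite /annulus_radius -mulrBr ler_pM2l// lerBlDr -sqrtrV ?(ltW m1)//.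
rewrite -(@ler_pXn2r _ 2%N) ?nnegrE ?addr_ge0 ?sqrtr_ge0//.
rewrite sqrrD !sqr_sqrtr ?divr_ge0 ?invr_ge0//.
have := mulr_ge0 (sqrtr_ge0 (m%:R^-1 : R)) (sqrtr_ge0 (j%:R / m%:R)).
rewrite -natr1 mulrDl mul1r -mulr_natl; lra.
Qed.

(* Up to a rotation by a power of [unit_root N], which does not change the
   average, [z] is close to its modulus, and so to [x]. *)
Lemma rotation_average_close (f : R[i] -> R) (e : R) : continuous f ->
  compact (closure [set z | f z != 0]) -> 0 < e ->
  exists M, forall m N j z x, (M <= m)%N -> (M <= N)%N -> (j < m)%N ->
    annulus_radius r m j <= Normc.normc z < annulus_radius r m j.+1 ->
    annulus_radius r m j < x < annulus_radius r m j.+1 ->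
    `|rotation_average N f z - rotation_average N f x%:C| <= e.
Proof.
move=> cf kf e0; have [d d0 dP] := compact_support_uniform cf kf e0.
(* As [z] has modulus at most [r], this relative error amounts to at most [d / 2]. The other half of
   [d] is for the annulus width, which [M2] makes small enough. *)
have e1 : 0 < d / 2 / r by rewrite !divr_gt0.
have [M1 _ M1P] := rotate_near_real e1.
pose M2 := (Num.truncn ((2 * r / d) ^+ 2)).+1.
exists (maxn M1 M2).+1 => m N j z x; rewrite !gtn_max => /andP[_ Mm] /andP[MN _] jm zj xj.
have m0 := leq_ltn_trans (leq0n j) jm; have m1 : 0 < m%:R :> R by rewrite ltr0n.
have N0 : (0 < N)%N by exact: leq_ltn_trans MN.
have N1 : 0 < N%:R :> R by rewrite ltr0n.
have [l lP] := M1P N (ltnW MN) z.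
have tr : annulus_radius r m j.+1 <= r.
  rewrite -[leRHS](annulus_radius_last r m0).
  by move: jm; rewrite leq_eqVlt => /orP[/eqP->//|im]; rewrite ltW// annulus_radius_lt.
have h1 : Normc.normc (z * unit_root N ^+ l - (Normc.normc z)%:C) <= d / 2.
  apply: le_trans lP _; rewrite mulrAC ler_pdivrMr// ler_pM2l ?divr_gt0//.
  by case/andP: zj => _ /ltW/le_trans; exact.
have h2 : r / Num.sqrt m%:R < d / 2.
  rewrite ltr_pdivrMr ?sqrtr_gt0// -ltr_pdivrMl ?divr_gt0//.
  rewrite -[ltLHS]gtr0_norm ?mulr_gt0 ?invr_gt0 ?divr_gt0// -sqrtr_sqr ltr_sqrt//.
  rewrite (_ : (d / 2)^-1 * r = 2 * r / d); last by field; rewrite (gt_eqF d0).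
  by apply: lt_le_trans (truncnS_gt _) _; rewrite ler_nat ltnW.
have h3 : Normc.normc ((Normc.normc z)%:C - x%:C) < d / 2.
  apply: le_lt_trans h2; apply: le_trans (annulus_width j m0).
  rewrite -rmorphB/= expr0n/= addr0 sqrtr_sqr.
  by move: zj xj; case/andP=> ? ? /andP[? ?]; rewrite ler_norml; apply/andP; split; lra.
have h4 : Normc.normc (z * unit_root N ^+ l - x%:C) < d.
  have := le_normcD (z * unit_root N ^+ l - (Normc.normc z)%:C) ((Normc.normc z)%:C - x%:C).
  rewrite addrA subrK => h; apply: le_lt_trans h _; lra.
rewrite -(rotation_average_unit_root f l z N0) /rotation_average -mulrBr -sumrB.
rewrite normrM normfV (gtr0_norm N1) ler_pdivrMl//.
apply: le_trans (ler_norm_sum _ _ _) _.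
rewrite mulr_natl -[N in leRHS]card_ord -sumr_const; apply: ler_sum => k _.
apply/ltW/dP; rewrite -mulrBr Normc.normcM normc_unit_rootX mul1r.
by rewrite [unit_root N ^+ l * z]mulrC.
Qed.

(** Averaging over rotations preserves the integral, and the average [F] varies little on each
    annulus. Upper sums for [F] and [- F] then bound the integral from both sides. *)
Lemma disk_equidistribution (f : R[i] -> R) (e : R) : continuous f ->
  compact (closure [set z | f z != 0]) -> 0 < e ->
  exists M, forall m N rho, (M <= m)%N -> (M <= N)%N -> (0 < m)%N -> (0 < N)%N ->
    (forall j, (j < m)%N -> annulus_radius r m j < rho j < annulus_radius r m j.+1) ->
    `|fine (\int[mu]_z (f z)%:E)%E
      - m%:R^-1 * \sum_(j < m) rotation_average N f (rho j)%:C| <= e.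
Proof.
move=> cf kf e0; have [M MP] := rotation_average_close cf kf e0.
exists M => m N rho Mm MN m0 N0 rhoP.
have mf := continuous_measurableC cf; have bf := compact_support_bounded cf kf.
have mF := measurable_rotation_average N mf.
have bF := bounded_rotation_average N0 bf.
have iF := disk_integrable r0 mF bF.
have m1 : 0 < m%:R :> R by rewrite ltr0n.
set F := rotation_average N f in mF bF iF *.
have /fineK fE : (\int[mu]_z (f z)%:E)%E \is a fin_num.
  exact: integrable_fin_num (disk_integrable r0 mf bf).
have up : (\int[mu]_z (F z)%:E <= (m%:R^-1 * \sum_(j < m) (F (rho j)%:C + e))%:E)%E.
  apply: (@disk_integral_le R r r0 m F (fun j => F (rho j)%:C + e)) => // j z jm zj.
  have := MP m N j z (rho j) Mm MN jm zj (rhoP j jm).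
  by rewrite ler_norml => /andP[_]; rewrite lerBlDl addrC.
have lo : (\int[mu]_z (- F z)%:E <= (m%:R^-1 * \sum_(j < m) (- F (rho j)%:C + e))%:E)%E.
  apply: (@disk_integral_le R r r0 m (fun z => - F z) (fun j => - F (rho j)%:C + e)) => //.
  - exact: measurable_funN.
  - by case: bF => B [Br BP]; exists B; split=> // x Bx y _; rewrite /= normrN; exact: (BP x Bx).
  move=> j z jm zj; have := MP m N j z (rho j) Mm MN jm zj (rhoP j jm).
  rewrite -/F ler_norml => /andP[+ _].
  by move: (F z) (F (rho j)%:C) => a b; lra.
have eN : (\int[mu]_z (- F z)%:E = - \int[mu]_z (F z)%:E)%E.
  under eq_integral do rewrite -mulN1r EFinM.
  by rewrite integralZl// EFinN mulN1e.
move: up lo; rewrite eN integral_rotation_average// -fE -EFinN !lee_fin !big_split/=.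
have me : m%:R^-1 * (e *+ m) = e by rewrite -[X in _ * X]mulr_natl mulKf ?gt_eqF.
rewrite sumr_const card_ord sumrN !mulrDr me mulrN => up lo.
by rewrite ler_norml; apply/andP; split; lra.
Qed.

(** A point of the disk outside [E] would be the center of a square [I * J] of positive area inside
    the null set. *)
Lemma disk_sub_support (E : set R[i]) : closed E -> mu (~` E) = 0%E -> disk r `<=` E.
Proof.
move=> cE E0 z zr; apply: contrapT => zE.
have oV : open (~` E `&` disk r).
  apply: openI; first exact: closed_openC.
  rewrite (_ : disk r = ball (0 : R[i]) r%:C); first by apply: ball_open; rewrite ltcR.
  by apply/seteqP; split=> w; rewrite /ball/= sub0r normrN.
have V0 : area (~` E `&` disk r) = 0%E.
  move/eqP: E0; rewrite disk_uniformE mule_eq0 eqe invr_eq0 mulf_eq0 expf_eq0/=.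
  by rewrite (gt_eqF r0) (gt_eqF (pi_gt0 R))/= => /eqP.
have : nbhs z (~` E `&` disk r) by exact: open_nbhs_nbhs.
rewrite -nbhs_ballE => -[e0 /= e0_gt0 eV].
have e0E : e0 = (complex.Re e0)%:C by rewrite RRe_real// gtr0_real.
move: e0E e0_gt0 eV; move: (complex.Re e0) => e -> {e0}; rewrite ltcR => e0 eV.
case: z zr zE eV => x y _ _ eV.
have e4 : 0 < e / 4 by rewrite divr_gt0.
pose I : set (measurableTypeR R) := ball (x : R) (e / 4).
pose J : set (measurableTypeR R) := ball (y : R) (e / 4).
have mI : measurable I by exact: measurable_ball.
have mJ : measurable J by exact: measurable_ball.
have sub : I `*` J `<=` @of_plane R @^-1` (~` E `&` disk r).
  move=> [x' y'] [/= Ix Jy]; apply: eV; rewrite /ball/= /of_plane/=.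
  apply: le_lt_trans (norm_of_plane_le _ _) _; rewrite ltcR.
  by move: Ix Jy; rewrite /I /J /ball/=; lra.
have : ((lebesgue_measure \x lebesgue_measure) (I `*` J) <= area (~` E `&` disk r))%E.
  apply: le_measure => //; rewrite ?inE//; first exact: measurableX.
  by rewrite -[X in measurable X]setTI; apply: measurable_of_plane => //; exact: open_measurableC.
rewrite V0 product_measure1E//= (lebesgue_measure_ball x (ltW e4)).
rewrite (lebesgue_measure_ball y (ltW e4)) -EFinM lee_fin.
by rewrite leNgt mulr_gt0// mulrn_wgt0.
Qed.

Lemma arithmetic_of_ge (E : set R[i]) : compact E -> mu (~` E) = 0%E ->
  expR (1 / 2) <= r -> arithmetic_measure E mu.
Proof.
move=> kE E0 er.
have DE : disk r `<=` E by apply: disk_sub_support => //; exact: compact_closed.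
(* With [n.+1] annuli and [N > n] points on each circle, both parameters tend to infinity. *)
have /choice[alpha alphaP] : forall n, exists z : R[i], exists (N : nat) (rho : nat -> R),
    [/\ (n < N)%N, algebraic_integer z,
    forall j, (j < n.+1)%N -> annulus_radius r n.+1 j < rho j < annulus_radius r n.+1 j.+1
  & perm_eq (galois_conjugates z)
      [seq (rho j)%:C * unit_root N ^+ k | j <- iota 0 n.+1, k <- iota 0 N]].
  move=> n; have := exists_conjugates_on_circles er (ltn0Sn n).
  move=> /(filterI (nbhs_infty_gt n))/filter_ex[N [nN [z [rho [? ? ?]]]]].
  by exists z, N, rho.
exists alpha; split.
- by move=> n; have [N [rho []]] := alphaP n.
(* All conjugates lie in the open disk, hence in [E], from the first index on. *)
- move=> U oU EU; exists 0%N => n _ b; have [N [rho [nN az rhoP gc]]] := alphaP n.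
  rewrite (perm_mem gc) => /allpairsP[[j k] [+ _ ->]]; rewrite mem_iota/= add0n => jn.
  have /andP[r1 r2] := rhoP j jn.
  apply/EU/DE; rewrite /disk/= -[`|_|]/((Normc.normc _)%:C) ltcR.
  rewrite Normc.normcM normc_unit_rootX mulr1 /= expr0n/= addr0 sqrtr_sqr ger0_norm; last first.
    by rewrite ltW// (le_lt_trans _ r1)// mulr_ge0// ltW.
  apply: lt_le_trans r2 _; rewrite -[leRHS](annulus_radius_last r (ltn0Sn n)).
  by move: jn; rewrite leq_eqVlt => /orP[/eqP->//|im]; rewrite ltW// annulus_radius_lt.
- move=> f cf kf; have mf := continuous_measurableC cf.
  have /fineK <- : (\int[mu]_z (f z)%:E)%E \is a fin_num.
    exact: integrable_fin_num (disk_integrable r0 mf (compact_support_bounded cf kf)).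
  rewrite (_ : (fun n => _) = EFin \o (fun n => (algdegree (alpha n))%:R^-1 *
      \sum_(b <- galois_conjugates (alpha n)) f b)); last first.
    by apply/funext => n /=; rewrite integral_conjugate_measure.
  apply: cvg_EFin; first exact: nearW.
  apply/cvgrPdist_le => e e0.
  have [M MP] := disk_equidistribution cf kf e0.
  exists M => // n /= Mn; have [N [rho [nN az rhoP gc]]] := alphaP n.
  have N0 : (0 < N)%N by exact: leq_ltn_trans nN.
  have := MP n.+1 N rho (leqW Mn) (leq_trans Mn (ltnW nN)) (ltn0Sn n) N0 rhoP.
  congr (`|_ - _| <= _).
  rewrite -size_galois_conjugates// (perm_size gc) (perm_big _ gc).
  rewrite size_allpairs !size_iota big_allpairs_dep natrM invfM -mulrA; congr (_ * _).
  rewrite -mulr_sumr; congr (_ * _).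
  rewrite -[iota 0 n.+1]/(index_iota 0 n.+1) big_mkord; apply: eq_bigr => j _.
  rewrite -[X in iota 0 X]subn0 -[iota 0 _]/(index_iota 0 N) big_mkord.
  by apply: eq_bigr => k _; rewrite mulrC.
Qed.

End sufficiency.

(** * Necessity *)

Section plane_topology.
Context {R : realType}.
Local Notation normc := (@Normc.normc R).

Lemma normc_ge0 z : 0 <= normc z.
Proof. by case: z => x y; exact: sqrtr_ge0. Qed.

Lemma continuous_normc : continuous (normc : R[i] -> R).
Proof.
move=> z A; rewrite -nbhs_ballE => -[e /= e0 eA].
apply: (@filterS _ _ _ (ball z e%:C)); last by apply: nbhsx_ballx; rewrite ltcR.
move=> w; rewrite /ball/= -[`|_|]/((normc _)%:C) ltcR => zw; apply: eA.
rewrite /ball/=; apply: le_lt_trans zw.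
rewrite ler_norml; apply/andP; split.
  rewrite lerNl opprB lerBlDl; have := le_normcD z (w - z).
  by rewrite addrC subrK -[X in _ -> _ <= _ + X]normcN opprB.
by rewrite lerBlDl; have := le_normcD w (z - w); rewrite addrC subrK.
Qed.

Lemma continuous_complex_of_pair : continuous (fun p : R * R => p.1 +i* p.2).
Proof.
move=> [x y] A; rewrite -nbhs_ballE => -[e0 /= e0_gt0 eA].
have e0E : e0 = (complex.Re e0)%:C by rewrite RRe_real// gtr0_real.
move: e0E e0_gt0 eA; move: (complex.Re e0) => e -> {e0}; rewrite ltcR => e0 eA.
have e2 : 0 < e / 2 by rewrite divr_gt0.
rewrite /nbhs/=; exists (ball x (e / 2), ball y (e / 2)) => /=.
  by split; exact: nbhsx_ballx.
move=> [x' y'] [/= Ix Jy]; apply: eA; rewrite /ball/=.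
apply: le_lt_trans (norm_of_plane_le _ _) _; rewrite ltcR.
by move: Ix Jy; rewrite /ball/=; lra.
Qed.

(** A closed subset of the image of a compact square. *)
Lemma compact_closed_disk (C : R) : compact [set z : R[i] | normc z <= C].
Proof.
have kI : compact `[- C, C]%classic by exact: segment_compact.
have kB := continuous_compact (continuous_subspaceT continuous_complex_of_pair)
  (compact_setX kI kI).
apply: (subclosed_compact _ kB).
  have -> : [set z : R[i] | normc z <= C] = normc @^-1` [set x | x <= C] by [].
  by apply: closed_comp => [z _|]; [exact: continuous_normc|exact: closed_le].
move=> [x y] /= h; have c0 : 0 <= C by rewrite (le_trans _ h) ?sqrtr_ge0.
have sq (u v : R) : Num.sqrt (u ^+ 2 + v ^+ 2) <= C -> `|u| <= C.
  move=> uv; have : Num.sqrt (u ^+ 2 + v ^+ 2) ^+ 2 <= C ^+ 2.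
    by rewrite ler_pXn2r ?nnegrE ?sqrtr_ge0.
  rewrite sqr_sqrtr ?addr_ge0 ?sqr_ge0// => uv2.
  rewrite -(@ler_pXn2r _ 2%N) ?nnegrE// real_normK ?num_real//.
  by apply: le_trans uv2; rewrite lerDl sqr_ge0.
exists (x, y) => //=; split=> /=; rewrite in_itv/= -ler_norml; first exact: sq h.
by apply: (sq y x); rewrite addrC.
Qed.

Lemma compact_normc_bounded (E : set R[i]) : compact E -> exists B, forall z, E z -> normc z <= B.
Proof.
move=> kE; have /compact_bounded : compact (normc @` E).
  by apply: continuous_compact => //; exact/continuous_subspaceT/continuous_normc.
move=> [M [Mr MP]]; exists (M + 1) => z Ez.
have M1 : M < M + 1 by rewrite ltrDl.
apply: le_trans (ler_norm _) _; apply: (MP _ M1); by exists z.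
Qed.

Lemma radial_test_function (h : R -> R) (C : R) : continuous h ->
  (forall t, C <= t -> h t = 0) ->
  continuous (h \o normc) /\ compact (closure [set z : R[i] | (h \o normc) z != 0]).
Proof.
move=> ch h0; split.
  by move=> z; apply: continuous_comp; [exact: continuous_normc|exact: ch].
apply: (subclosed_compact _ (@compact_closed_disk C)); first exact: closed_closure.
have -> : [set z : R[i] | normc z <= C] = closure [set z : R[i] | normc z <= C].
  by apply/closure_id; apply: compact_closed; [exact: norm_hausdorff|exact: compact_closed_disk].
apply: closure_subset => z /=; apply: contra_neqT; rewrite -ltNge => zC.
exact/h0/ltW.
Qed.

End plane_topology.

(** * The truncated logarithm as a test function *)

Section necessity.
Context {R : realType}.
Local Notation normc := (@Normc.normc R).
Variables (r : R) (r0 : 0 < r).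
Local Notation mu := (disk_uniform r0).

Lemma sum_ln (I : Type) (s : seq I) (F : I -> R) : (forall i, 0 < F i) ->
  \sum_(i <- s) ln (F i) = ln (\prod_(i <- s) F i).
Proof.
move=> F0; elim: s => [|i s ih]; first by rewrite !big_nil ln1.
by rewrite !big_cons ih lnM ?posrE// prodr_gt0.
Qed.

(** Up to the factor [m], this is an upper sum for the integral of [ln |z|], with outer radii so
    that each logarithm is taken at a positive number. It is negative by [exists_fact_small] at
    [s = r ^+ 2]. *)
Lemma sum_ln_annulus_radius_lt0 : r < expR (1 / 2) -> exists2 m, (0 < m)%N &
  \sum_(j < m) ln (annulus_radius r m j.+1) < 0.
Proof.
move=> re; have s1 : r ^+ 2 < expR 1.
  have -> : expR 1 = expR (1 / 2) ^+ 2 :> R by rewrite -expRM_natl; congr expR; lra.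
  by rewrite ltr_pXn2r ?nnegrE ?expR_ge0 ?(ltW r0).
have [m m0 mP] := exists_fact_small (exprn_gt0 2 r0) s1.
exists m => //; have m1 : 0 < m%:R :> R by rewrite ltr0n.
have t_gt0 j : 0 < annulus_radius r m j.+1.
  by rewrite -(annulus_radius0 r m) annulus_radius_lt.
have P0 : 0 < \prod_(j < m) annulus_radius r m j.+1 by exact: prodr_gt0.
have P1 : \prod_(j < m) annulus_radius r m j.+1 < 1.
  rewrite -(@ltr_pXn2r _ 2%N)// ?nnegrE ?(ltW P0)// expr1n prod_annulus_radius_sqr.
  by rewrite ltr_pdivrMr ?exprn_gt0// mul1r.
by rewrite (sum_ln _ (fun j : 'I_m => t_gt0 j)) -ltr_expR expR0 lnK.
Qed.

Lemma conjugate_average_cvg (alpha : nat -> R[i]) (f : R[i] -> R) :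
  weak_star_cvg (fun n => conjugate_measure (alpha n)) mu -> continuous f ->
  compact (closure [set z | f z != 0]) ->
  ((algdegree (alpha n))%:R^-1 * \sum_(b <- galois_conjugates (alpha n)) f b) @[n --> \oo]
    --> fine (\int[mu]_z (f z)%:E)%E.
Proof.
move=> wc cf kf; have mf := continuous_measurableC cf.
have /fineK fE : (\int[mu]_z (f z)%:E)%E \is a fin_num.
  exact: integrable_fin_num (disk_integrable r0 mf (compact_support_bounded cf kf)).
have := wc f cf kf; rewrite -{1}fE => /fine_cvg.
apply: cvg_trans; apply: near_eq_cvg; apply: nearW => n /=.
by rewrite integral_conjugate_measure.
Qed.

Lemma galois_conjugates0 : algebraic_integer (0 : R[i]) /\ galois_conjugates (0 : R[i]) = [:: 0].
Proof.
have a0 : algebraic_integer (0 : R[i]) by exists (polyX _); rewrite ?monicX ?map_polyX ?rootX.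
split=> //; have := galois_conjugatesE a0.
have -> : minpolyQ (0 : R[i]) = 'X.
  apply: minpolyQ_unique; rewrite ?monicX ?map_polyX ?rootX//.
  by rewrite -['X]subr0; exact: irredp_XsubC.
rewrite map_polyX => e; apply/perm_small_eq => //.
by rewrite perm_sym; apply: prod_XsubC_eq; rewrite -e big_seq1 subr0.
Qed.

(* The test function separates the Dirac mass at 0, which is the conjugate measure of
   0, from the uniform measure. *)
Lemma eventually_neq0 (alpha : nat -> R[i]) :
  weak_star_cvg (fun n => conjugate_measure (alpha n)) mu ->
  \forall n \near \oo, alpha n != 0.
Proof.
(* The disk of radius [d] carries half the mass, so the integral of the test function is at most
   1/2, while its value at 0 is 1. *)
move=> wc; pose d := annulus_radius r 2 1.
have d0 : 0 < d by rewrite -(annulus_radius0 r 2) annulus_radius_lt.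
pose h (t : R) := Num.max (1 - t / d) 0.
have ch : continuous h.
  apply: max_fun_continuous => t; last exact: cvg_cst.
  by apply: cvgB; [exact: cvg_cst|apply: cvgM; [exact: cvg_id|exact: cvg_cst]].
have h0 t : d <= t -> h t = 0.
  by move=> dt; apply/max_idPr; rewrite subr_le0 ler_pdivlMr ?mul1r.
have [cf kf] := radial_test_function ch h0.
have I1 : fine (\int[mu]_z ((h \o normc) z)%:E)%E < 1.
  have mf := continuous_measurableC cf; have bf := compact_support_bounded cf kf.
  have /fineK fE : (\int[mu]_z ((h \o normc) z)%:E)%E \is a fin_num.
    exact: integrable_fin_num (disk_integrable r0 mf bf).
  rewrite -lte_fin fE.
  apply: le_lt_trans (disk_integral_le r0 (isT : (0 < 2)%N) mf bf
    (_ : forall j z, (j < 2)%N -> _ -> _ <= (j == 0%N)%:R)) _.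
    move=> [|[|//]] z _ /andP[z1 z2] /=.
      by rewrite ge_max ler01 andbT gerBl divr_ge0 ?normc_ge0 ?(ltW d0).
    by rewrite -/(normc z) h0.
  rewrite !big_ord_recl big_ord0/= lte_fin; lra.
have H : \forall n \near \oo, (algdegree (alpha n))%:R^-1 *
    \sum_(b <- galois_conjugates (alpha n)) (h \o normc) b < 1.
  by apply: cvgr_lt I1; exact: conjugate_average_cvg.
apply: filterS H => n; apply: contraTneq => ->.
have [a0 gE] := galois_conjugates0.
rewrite -size_galois_conjugates// gE big_seq1/= invr1 mul1r -leNgt.
by rewrite /h le_max expr0n/= addr0 sqrtr0 mul0r subr0 lexx.
Qed.

Lemma ge_of_arithmetic (E : set R[i]) : compact E -> arithmetic_measure E mu ->
  expR (1 / 2) <= r.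
Proof.
move=> kE [alpha [int_alpha alphaU wc]]; rewrite leNgt; apply/negP => re.
have [m m0 lnm] := sum_ln_annulus_radius_lt0 re.
(* The first bound puts [E] inside the open disk of radius [B]; the second makes the cutoff equal to
   1 where the uniform measure lives. *)
have [B0 B0P] := compact_normc_bounded kE; pose B := Num.max (B0 + 1) r.
have m1 : 0 < m%:R :> R by rewrite ltr0n.
(* Truncating the logarithm at the smallest outer radius leaves the upper sum over the annuli
   unchanged. *)
pose d := annulus_radius r m 1.
have d0 : 0 < d by rewrite -(annulus_radius0 r m) annulus_radius_lt.
pose cut (t : R) := Num.min 1 (Num.max 0 (B + 1 - t)).
pose g (t : R) := ln (Num.max t d).
pose h t := g t * cut t.
have cg : continuous g.
  move=> t; apply: (@continuous_comp _ _ _ (fun t => Num.max t d) (@ln R)).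
    by apply: max_fun_continuous => x; [exact: cvg_id|exact: cvg_cst].
  by apply: continuous_ln; rewrite lt_max d0 orbT.
have cm : continuous (fun t : R => Num.max 0 (B + 1 - t)).
  apply: max_fun_continuous => y; first exact: cvg_cst.
  by apply: cvgB; [exact: cvg_cst|exact: cvg_id].
have cc : continuous cut.
  by apply: min_fun_continuous => // x; exact: cvg_cst.
have ch : continuous h by move=> t; apply: cvgM; [exact: cg|exact: cc].
have h0 t : B + 1 <= t -> h t = 0.
  move=> dt; rewrite /h /cut (_ : Num.max _ _ = 0); last by apply/max_idPl; rewrite subr_le0.
  by rewrite (_ : Num.min _ _ = 0) ?mulr0//; apply/min_idPr.
have hE t : t <= B -> h t = g t.
  move=> tB; rewrite /h /cut (_ : Num.min _ _ = 1) ?mulr1//; apply/min_idPl.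
  by rewrite le_max lerBrDr addrC lerD2r tB orbT.
have [cf kf] := radial_test_function ch h0.
have I0 : fine (\int[mu]_z ((h \o normc) z)%:E)%E < 0.
  have mf := continuous_measurableC cf; have bf := compact_support_bounded cf kf.
  have /fineK fE : (\int[mu]_z ((h \o normc) z)%:E)%E \is a fin_num.
    exact: integrable_fin_num (disk_integrable r0 mf bf).
  rewrite -lte_fin fE.
  apply: le_lt_trans (disk_integral_le r0 m0 mf bf
    (_ : forall j z, (j < m)%N -> _ -> _ <= ln (annulus_radius r m j.+1))) _.
    move=> j z jm /andP[z1 z2].
    have tr : annulus_radius r m j.+1 <= r.
      rewrite -[leRHS](annulus_radius_last r m0).
      by move: jm; rewrite leq_eqVlt => /orP[/eqP->//|im]; rewrite ltW// annulus_radius_lt.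
    rewrite [X in X <= _]/comp hE; last by rewrite le_max (le_trans (ltW z2) tr) orbT.
    have dj : d <= annulus_radius r m j.+1.
      by case: (j) => // k; rewrite ltW// annulus_radius_lt.
    rewrite ler_ln ?posrE ?lt_max ?d0 ?orbT//; last exact: lt_le_trans dj.
    by rewrite ge_max (ltW z2).
  by rewrite lte_fin pmulr_rlt0 ?invr_gt0.
have oU : open [set z : R[i] | normc z < B].
  have -> : [set z : R[i] | normc z < B] = (normc : R[i] -> R) @^-1` [set x | x < B] by [].
  by move/continuousP : (@continuous_normc R); apply; exact: open_lt.
have EU : E `<=` [set z : R[i] | normc z < B].
  by move=> z Ez; apply: le_lt_trans (B0P z Ez) _; rewrite lt_max ltrDl ltr01.
have [N NP] := alphaU _ oU EU.
have neq0 := eventually_neq0 wc.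
have avg : \forall n \near \oo, (algdegree (alpha n))%:R^-1 *
    \sum_(b <- galois_conjugates (alpha n)) (h \o normc) b < 0.
  by apply: cvgr_lt I0; exact: conjugate_average_cvg.
have [n [Nn [an0 an]]] := filter_ex (filterI (nbhs_infty_ge N) (filterI neq0 avg)).
move: an; rewrite ltNge => /negP; apply; apply: mulr_ge0; first by rewrite invr_ge0.
(* For [n >= N] all conjugates have modulus below [B], where the cutoff is 1. Truncation from below
   only enlarges the product of moduli, which is already at least 1. *)
rewrite big_seq (eq_bigr (fun b => g (normc b))); last first.
  by move=> b bn; rewrite [LHS]/comp hE// ltW//; exact: NP bn.
rewrite -big_seq sum_ln => [|b]; last by rewrite lt_max d0 orbT.
rewrite ln_ge0//; apply: le_trans (prod_conjugates_ge1 (int_alpha n) an0) _.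
by apply: ler_prod => b _; rewrite normc_ge0 le_max lexx.
Qed.

End necessity.

Theorem theorem6p7 (R : realType) (r : R) (r0 : 0 < r) (E : set R[i])
  (compactE : compact E) (symE : conj_symmetric E)
  (suppE : disk_uniform r0 (~` E) = 0%E) :
  arithmetic_measure E (disk_uniform r0) <-> expR (1 / 2) <= r.
Proof.
split; first exact: ge_of_arithmetic.
exact: arithmetic_of_ge.
Qed.
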